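(* Let $\alpha\in\mathbb{R}\setminus\pi\mathbb{Z}$ and $z=\rho i$ with $\rho\in\mathbb{R}\setminus\{0\}$, and let $\mathcal{O}_\alpha$ be the integral transform with parameters $\alpha,z$ defined in the context. Let $0\le\lambda<1$ and $$C_\lambda=\pi^\lambda\left[\frac{\Gamma\left(\frac{1-\lambda}{4}\right)}{\Gamma\left(\frac{1+\lambda}{4}\right)}\right]^2 .$$ Then for every function $f\in\mathcal{S}(\mathbb{R})$, $$|\csc\alpha|^{-\lambda}\int_{\mathbb{R}}|s|^{-\lambda}\,|\mathcal{O}_\alpha[f](s)|^2\,ds\le\frac14\,C_\lambda\,(1+|z|^2)\int_{\mathbb{R}}|t|^\lambda|f(t)|^2\,dt .$$
   Context: For $\alpha\in\mathbb{R}\setminus\pi\mathbb{Z}$ put $a=\frac{\cot\alpha}{2}$ and $c(\alpha)=\sqrt{1-i\cot\alpha}$ (principal square root). For $z=\rho i$, $\rho\in\mathbb{R}\setminus\{0\}$, and $f\in L^1(\mathbb{R})$ (complex-valued), define $$\mathcal{O}_\alpha[f](s)=\frac{c(\alpha)}{\sqrt{2\pi}}\,e^{ias^2}\int_{\mathbb{R}}\frac{e^{-ist\csc\alpha}+z\,e^{ist\csc\alpha}}{2}\,e^{iat^2}f(t)\,dt,\qquad s\in\mathbb{R}.$$ $\mathcal{S}(\mathbb{R})$ is the Schwartz space of complex-valued rapidly decreasing smooth functions on $\mathbb{R}$, and $\Gamma$ is the Euler Gamma function. *)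

(* Defs.v *)
From HB Require Import structures.
From mathcomp Require Import all_boot all_order all_algebra.
From mathcomp Require Import all_classical all_reals all_analysis.
From mathcomp Require Import complex.

Set Implicit Arguments.
Unset Strict Implicit.
Unset Printing Implicit Defensive.

Import Order.TTheory GRing.Theory Num.Theory.
Import numFieldNormedType.Exports.

Local Open Scope classical_set_scope.
Local Open Scope ring_scope.
Local Open Scope complex_scope.

Definition cot (R : realType) (x : R) : R := cos x / sin x.

Definition csc (R : realType) (x : R) : R := (sin x)^-1.

(* Convergent, hence meaningful, for 0 < x only. *)
Definition Gamma (R : realType) (x : R) : R :=
  \int[lebesgue_measure]_(t in `]0, +oo[) (t `^ (x - 1) * expR (- t)).

(* The complex modulus as a real number: the norm `|w| of R[i] takes its values
   in R[i] itself. *)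
Definition cmod (R : realType) (w : R[i]) : R := Normc.normc w.

Definition expi (R : realType) (x : R) : R[i] := cos x +i* sin x.

Definition cintegral (R : realType) (g : R -> R[i]) : R[i] :=
  (\int[lebesgue_measure]_t complex.Re (g t)) +i*
  (\int[lebesgue_measure]_t complex.Im (g t)).

(* R[i] carries no normed module structure over R, so the derivatives of a
   complex-valued function of a real variable are taken componentwise. *)
Definition cderive1n (R : realType) (n : nat) (f : R -> R[i]) (t : R) : R[i] :=
  derive1n n (@complex.Re R \o f) t +i* derive1n n (@complex.Im R \o f) t.

Definition csmooth (R : realType) (f : R -> R[i]) : Prop :=
  forall (n : nat) (t : R),
    derivable (derive1n n (@complex.Re R \o f)) t 1 /\
    derivable (derive1n n (@complex.Im R \o f)) t 1.

Definition schwartz (R : realType) (f : R -> R[i]) : Prop :=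
  csmooth f /\
  forall m n : nat, exists M : R, forall t : R,
    `|t| ^+ m * cmod (cderive1n n f t) <= M.

(* sqrtc is the principal square root (nonnegative real part), unlike the
   generic sqrtC, whose values have nonnegative imaginary part. *)
Definition cfactor (R : realType) (alpha : R) : R[i] :=
  sqrtc (1 -i* cot alpha).

Definition Otransform (R : realType) (alpha : R) (z : R[i]) (f : R -> R[i])
    (s : R) : R[i] :=
  let a := cot alpha / 2 in
  cfactor alpha / (Num.sqrt (2 * pi))%:C * expi (a * s ^+ 2) *
  cintegral (fun t : R =>
    (expi (- (s * t * csc alpha)) + z * expi (s * t * csc alpha)) / 2
    * expi (a * t ^+ 2) * f t).

Definition pitt_const (R : realType) (lambda : R) : R :=
  pi `^ lambda * (Gamma ((1 - lambda) / 4) / Gamma ((1 + lambda) / 4)) ^+ 2.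

(* Main.v *)
Require Import Defs.
From HB Require Import structures.
From mathcomp Require Import all_boot all_order all_algebra.
From mathcomp Require Import all_classical all_reals all_analysis.
From mathcomp Require Import measurable_realfun.
From mathcomp Require Import complex ring lra.

Set Implicit Arguments.
Unset Strict Implicit.
Unset Printing Implicit Defensive.

Import Order.TTheory GRing.Theory Num.Theory.
Import numFieldNormedType.Exports.

Local Open Scope classical_set_scope.
Local Open Scope ring_scope.
Local Open Scope complex_scope.

(** Write g t = e^{i t^2 cot(alpha) / 2} f t and let G be the Fourier transform
    of g.  Since |c(alpha)|^2 = |csc alpha|,
    |O f (s)|^2 = |csc alpha| / (8 pi) * |G(k s) + z G(- k s)|^2 with k = csc alpha.
    As z is purely imaginary, the cross term of the square is odd and integrates
    to 0 against an even weight, so the claim reduces to Pitt's inequality for the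
    real and imaginary parts p of g separately.

    To prove the latter, put lambda = 2 a and |w|^{- 2 a} Gamma(a) =
    \int_0^oo u^{a-1} e^{- u w^2} du.  For fixed u, the Fourier transform of the
    Gaussian turns \int e^{- u w^2} |G w|^2 dw into a quadratic form with a
    Gaussian kernel, which the Schur test with weight |x|^{- 2 c},
    c = (1 + lambda) / 4, bounds by a weighted integral of p^2.  The weight is
    itself a Gamma mixture of Gaussians, so all remaining integrals are Gaussian,
    Gamma and Beta integrals.  They give the constant
    2 pi 2^{- lambda} (Gamma((1 - lambda) / 4) / Gamma((1 + lambda) / 4))^2, which is
    enough as 2^{- lambda} <= pi^lambda.  For lambda = 0 the weight 1 and u --> 0 give
    Plancherel's inequality. *)

(** * Affine changes of variables *)

Section AffineSubstitution.
Context {R : realType}.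
Notation mu := (@lebesgue_measure R).

Let affine (a b : R) : measurableTypeR R -> measurableTypeR R :=
  fun x => a * x + b.

Let measurable_affine a b : measurable_fun setT (affine a b).
Proof.
apply: (@measurable_funD _ (measurableTypeR R)); first exact: mulrl_measurable.
exact: measurable_cst.
Qed.

Let affine_measure (a b : R) (a0 : 0 < a) :
    {measure set (measurableTypeR R) -> \bar R}.
Proof.
pose k : {nonneg R} := NngNum (ltW a0).
apply: (mscale k (pushforward mu (affine a b)) : {measure set (measurableTypeR R) -> \bar R}).
exact: measurable_affine.
Defined.

(** The preimage of []c, d]] under [a x + b] has length [(d - c) / a], so the factor [a] restores
    the length, and Lebesgue measure is determined by its values on half-open intervals. *)
Let affine_measureE (a b : R) (a0 : 0 < a) (A : set (measurableTypeR R)) :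
  measurable A -> affine_measure b a0 A = mu A.
Proof.
move=> mA; apply/esym.
apply: (@lebesgue_measure_unique R (affine_measure b a0)) => // X [[c d] /= _ <-].
rewrite /affine_measure/= /mscale /=.
have -> : pushforward mu (affine a b) `]c, d] = mu `](c - b) / a, (d - b) / a].
  rewrite /pushforward; congr (mu _).
  apply/seteqP; split => x /=; rewrite !in_itv/= /affine.
    by move=> /andP[h1 h2]; rewrite ltr_pdivrMr// ler_pdivlMr//; apply/andP; split; lra.
  by rewrite ltr_pdivrMr// ler_pdivlMr// => /andP[h1 h2]; apply/andP; split; lra.
rewrite !lebesgue_measure_itv/= !lte_fin ltr_pM2r ?invr_gt0// ltrD2r.
case: ifPn => // _; last by rewrite mule0.
by rewrite -!EFinB -EFinM; congr EFin; field; rewrite gt_eqF.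
Qed.

Lemma ge0_integral_affine (a b : R) (f : R -> \bar R) : a != 0 ->
  measurable_fun setT f -> (forall x, 0 <= f x)%E ->
  (\int[mu]_x f (a * x + b)%R = `|a|^-1%:E * \int[mu]_x f x)%E.
Proof.
(* A negative slope is a positive one followed by the reflection [x -> - x], which preserves
   Lebesgue measure. *)
wlog a0 : a b f / 0 < a => [hwlog|] aneq0 mf f0.
  case: (ltP 0 a) => [a0|]; first exact: hwlog.
  rewrite le_eqVlt (negbTE aneq0)/= => a0.
  have -> : (\int[mu]_x f (a * x + b)%R = \int[mu]_x f (- (- a * x - b))%R)%E.
    by apply: eq_integral => x _; congr f; ring.
  rewrite (hwlog (- a) (- b) (fun x => f (- x))) ?oppr_gt0 ?oppr_eq0//; last first.
    exact: measurableT_comp.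
  rewrite normrN; congr (_ * _)%E.
  rewrite [RHS](@eq_measure_integral _ _ _ _ (pushforward mu (-%R : _ -> measurableTypeR R))).
    by rewrite ge0_integral_pushforward//=; exact: oppr_measurable.
  by move=> A mA _; apply/esym; exact: lebesgue_measureN.
rewrite -[in RHS](@eq_measure_integral _ _ _ _ mu (affine_measure b a0)).
  rewrite ge0_integral_mscale//= ge0_integral_pushforward//=.
  by rewrite muleA -EFinM gtr0_norm// mulVf// mul1e.
by move=> A mA _; exact: affine_measureE.
Qed.

Lemma integrable_affine (a b : R) (f : R -> R) : a != 0 ->
  mu.-integrable setT (EFin \o f) ->
  mu.-integrable setT (EFin \o (fun x => f (a * x + b))).
Proof.
move=> a0 /integrableP[mf intf]; apply/integrableP; split.
  by apply: (measurableT_comp mf); exact: measurable_affine.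
have := @ge0_integral_affine a b (abse \o (EFin \o f)) a0.
rewrite /= => ->//; last exact: measurableT_comp.
by rewrite lte_mul_pinfty// ge0_fin_numE// integral_ge0.
Qed.

Lemma Rintegral_affine (a b : R) (f : R -> R) : a != 0 ->
  mu.-integrable setT (EFin \o f) ->
  \int[mu]_x f (a * x + b) = `|a|^-1 * \int[mu]_x f x.
Proof.
move=> a0 intf; have mf := measurable_int _ intf.
rewrite /Rintegral.
have -> : (\int[mu]_x (f (a * x + b))%:E = `|a|^-1%:E * \int[mu]_x (f x)%:E)%E.
  (* The nonnegative case applies to the positive and the negative part; integrability keeps their
     difference well defined. *)
  rewrite integralE [in RHS]integralE.
  have fin1 : (\int[mu]_x (EFin \o f)^\+ x \is a fin_num)%E.
    exact: integrable_pos_fin_num.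
  have fin2 : (\int[mu]_x (EFin \o f)^\- x \is a fin_num)%E.
    exact: integrable_neg_fin_num.
  rewrite muleBr//; last exact: fin_num_adde_defr.
  have mp : measurable_fun setT ((EFin \o f)^\+)%E by exact: measurable_funepos.
  have mn : measurable_fun setT ((EFin \o f)^\-)%E by exact: measurable_funeneg.
  rewrite -(ge0_integral_affine b a0 mp)// -(ge0_integral_affine b a0 mn)//.
  by congr (_ - _)%E; apply: eq_integral => x _; rewrite ?funeposE ?funenegE.
by rewrite fineM//; exact: integrable_fin_num.
Qed.

End AffineSubstitution.

(** * The Fourier transform of a Gaussian *)

Section Gaussian.
Context {R : realType}.
Notation mu := (@lebesgue_measure R).
Implicit Types u m d w x y : R.

Lemma measurable_cos : measurable_fun setT (@cos R).
Proof. by apply: continuous_measurable_fun; exact: continuous_cos. Qed.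

Lemma measurable_sin : measurable_fun setT (@sin R).
Proof. by apply: continuous_measurable_fun; exact: continuous_sin. Qed.

Lemma integrable_mull (k : R) (f : R -> R) : mu.-integrable setT (EFin \o f) ->
  mu.-integrable setT (EFin \o (fun x => k * f x)).
Proof.
move=> intf; have := integrableZl measurableT k intf.
by apply: eq_integrable => // x _ /=; rewrite EFinM.
Qed.

Lemma measurable_gauss u m : measurable_fun setT (fun w : R => expR (- (u * (w - m) ^+ 2))).
Proof.
apply: measurableT_comp => //; apply: measurableT_comp => //.
apply: measurable_funM => //; apply: measurable_funX.
exact: measurable_funB.
Qed.

Lemma integral_gauss u m : 0 < u ->
  (\int[mu]_w (expR (- (u * (w - m) ^+ 2)))%:E = (Num.sqrt (pi / u))%:E)%E.
Proof.
move=> u0; have su0 : 0 < Num.sqrt u by rewrite sqrtr_gt0.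
transitivity (\int[mu]_w (EFin \o gauss_fun) (Num.sqrt u * w + - (Num.sqrt u * m))%R)%E.
  apply: eq_integral => w _ /=; congr (expR (- _))%:E.
  by rewrite -mulrBr exprMn sqr_sqrtr// ltW.
rewrite ge0_integral_affine ?gt_eqF//; last 2 first.
  by apply/measurable_EFinP; exact: measurable_gauss_fun.
  by move=> x; rewrite lee_fin gauss_fun_ge0.
rewrite integralT_gauss -EFinM gtr0_norm// sqrtrM ?pi_ge0// sqrtrV ?ltW//.
by rewrite mulrC.
Qed.

Lemma integrable_gauss u : 0 < u ->
  mu.-integrable setT (EFin \o (fun w => expR (- (u * w ^+ 2)))).
Proof.
move=> u0.
have E : (fun w => expR (- (u * w ^+ 2))) = (fun w => expR (- (u * (w - 0) ^+ 2))).
  by apply/funext => w; rewrite subr0.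
rewrite E; apply/integrableP; split.
  by apply/measurable_EFinP; exact: measurable_gauss.
under eq_integral do rewrite /= ger0_norm ?expR_ge0//.
by rewrite integral_gauss// ltry.
Qed.

Lemma integrable_gaussM u (h : R -> R) : 0 < u -> measurable_fun setT h ->
  (forall w, `|h w| <= expR (- (u * w ^+ 2))) -> mu.-integrable setT (EFin \o h).
Proof.
move=> u0 mh hle; apply: (le_integrable _ _ _ (integrable_gauss u0)) => //.
  exact/measurable_EFinP.
by move=> w _ /=; rewrite lee_fin (le_trans (hle w))// ler_norm.
Qed.

(** From [(|w| - 1)^2 >= 0] one gets [|w| <= 1 + w^2 / 2]. The factor [w] produced by
    differentiation is thereby absorbed into half of the Gaussian exponent. *)
Let absw_expR w : `|w| <= expR (w ^+ 2 / 2).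
Proof.
apply: le_trans (expR_ge1Dx _); have := sqr_ge0 (`|w| - 1).
rewrite sqrrB1 real_normK ?num_real// -mulr_natr; lra.
Qed.

(** As the Gaussian is even, this is its whole Fourier transform. It is computed below from the
    differential equation that it satisfies. *)
Let F d := \int[mu]_w (expR (- w ^+ 2) * cos (w * d)).

Let cvg_F d : derivable F d 1 /\
  derive1 F d = \int[mu]_w (- (w * expR (- w ^+ 2) * sin (w * d))).
Proof.
pose f x y := expR (- y ^+ 2) * cos (y * x) : R.
have df x y : is_derive x 1 (f ^~ y) (- (y * expR (- y ^+ 2) * sin (y * x))).
  rewrite /f; apply: is_derive_eq; rewrite /GRing.scale/=; ring.
have mcos x : measurable_fun setT (fun y => cos (y * x) : R).
  by apply: (measurableT_comp measurable_cos); exact: mulrr_measurable.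
have intf x : mu.-integrable setT (EFin \o f x).
  apply: (integrable_gaussM ltr01).
    apply: measurable_funM => //; apply: measurableT_comp => //.
    exact: measurableT_comp.
  move=> w; rewrite mul1r normrM ger0_norm ?expR_ge0// ler_piMr ?expR_ge0//.
  by rewrite ler_norml cos_geN1 cos_le1.
have G0 y : 0 <= expR (- (2^-1 * y ^+ 2)) :> R by exact: expR_ge0.
have Gub x y : `](d - 1), (d + 1)[%classic x -> setT y ->
    `|partial1of2 f x y| <= expR (- (2^-1 * y ^+ 2)).
  move=> _ _; rewrite partial1of2E (@derive_val _ _ _ _ _ _ _ (df x y)).
  rewrite normrN !normrM (ger0_norm (expR_ge0 _)).
  (* The dominating function does not depend on the frequency: [|y|] costs [y^2 / 2] of the exponent
     and leaves [e^{- y^2 / 2}]. *)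
  have -> : - (2^-1 * y ^+ 2) = y ^+ 2 / 2 - y ^+ 2 by lra.
  rewrite expRD -[leRHS]mulr1; apply: ler_pM; rewrite ?mulr_ge0 ?expR_ge0//.
    by rewrite ler_wpM2r ?expR_ge0.
  by rewrite ler_norml sin_geN1 sin_le1.
have dI : `](d - 1), (d + 1)[%classic d by rewrite /= in_itv/=; apply/andP; split; lra.
have iG : mu.-integrable setT (EFin \o (fun y => expR (- (2^-1 * y ^+ 2)))).
  by apply: integrable_gauss.
have df' x y : `](d - 1), (d + 1)[%classic x -> setT y -> derivable (f ^~ y) x 1.
  by move=> _ _; have [] := df x y.
split.
  exact: (derivable_under_integral measurableT dI (fun x _ => intf x) df' G0 iG Gub).
rewrite (differentiation_under_integral measurableT dI (fun x _ => intf x) df' G0 iG Gub).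
apply: eq_Rintegral => y _.
by rewrite partial1of2E (@derive_val _ _ _ _ _ _ _ (df d y)).
Qed.

(* By translation invariance [x |-> \int g (y + x) dy] is constant; the bound on
   g' allows differentiating it under the integral at 0. *)
Lemma Rintegral_derive_eq0 (g g' : R -> R) (C u : R) : 0 < u -> 0 <= C ->
  (forall x, is_derive x 1 g (g' x)) ->
  mu.-integrable setT (EFin \o g) ->
  (forall x, `|g' x| <= C * expR (- (u * x ^+ 2))) ->
  \int[mu]_x g' x = 0.
Proof.
move=> u0 C0 dg intg g'le.
pose f (x y : R) := g (1 * y + x).
have df x y : is_derive x 1 (f ^~ y) (g' (1 * y + x)).
  rewrite /f; have h := dg (1 * y + x).
  have := @is_derive1_comp R g (fun x => 1 * y + x) x (g' (1 * y + x)) 1 h.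
  rewrite mulr1; apply.
  by apply: is_derive_eq; rewrite add0r mulr1.
have intf x : mu.-integrable setT (EFin \o f x).
  exact: (integrable_affine x (oner_neq0 _) intg).
(* For [|x| < 1], [(y + x)^2 >= y^2 / 2 - x^2 >= y^2 / 2 - 1], which gives the factor [expR u] and
   the halved exponent. *)
pose G (y : R) := C * expR u * expR (- (u / 2 * y ^+ 2)).
have G0 y : 0 <= G y by rewrite !mulr_ge0// expR_ge0.
have Gub x y : `](-1), 1[%classic x -> setT y -> `|partial1of2 f x y| <= G y.
  rewrite /= in_itv/= => /andP[x1 x2] _.
  rewrite partial1of2E (@derive_val _ _ _ _ _ _ _ (df x y)) (le_trans (g'le _))//.
  rewrite /G -mulrA ler_wpM2l// -expRD ler_expR.
  have h1 : x ^+ 2 <= 1 by rewrite expr2; nra.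
  have h2 : y ^+ 2 / 2 - 1 <= (1 * y + x) ^+ 2.
    by have := sqr_ge0 (y + 2 * x); rewrite !expr2 in h1 *; lra.
  have : u * (y ^+ 2 / 2 - 1) <= u * (1 * y + x) ^+ 2 by rewrite ler_wpM2l// ltW.
  by lra.
have I0 : `](-1), 1[%classic (0 : R) by rewrite /= in_itv/= ltrN10 ltr01.
have iG : mu.-integrable setT (EFin \o G).
  by apply: integrable_mull; apply: integrable_gauss; rewrite divr_gt0.
have df' x y : `](-1), 1[%classic x -> setT y -> derivable (f ^~ y) x 1.
  by move=> _ _; have [] := df x y.
have := differentiation_under_integral measurableT I0 (fun x _ => intf x) df' G0 iG Gub.
have -> : (fun x' => \int[mu]_y f x' y) = cst (\int[mu]_y g y).
  by apply/funext => x; rewrite /f Rintegral_affine ?oner_neq0// normr1 invr1 mul1r.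
rewrite derive1_cst => /esym E; rewrite -[RHS]E; apply: eq_Rintegral => y _.
by rewrite partial1of2E (@derive_val _ _ _ _ _ _ _ (df 0 y)) mul1r addr0.
Qed.

Let integrable_F d : mu.-integrable setT (EFin \o (fun w => expR (- w ^+ 2) * cos (w * d))).
Proof.
apply: (integrable_gaussM ltr01).
  apply: measurable_funM; last by apply: (measurableT_comp measurable_cos); exact: mulrr_measurable.
  by apply: measurableT_comp => //; exact: measurableT_comp.
move=> w; rewrite mul1r normrM ger0_norm ?expR_ge0// ler_piMr ?expR_ge0//.
by rewrite ler_norml cos_geN1 cos_le1.
Qed.

Let norm_wexpR_sin w d : `|w * expR (- w ^+ 2) * sin (w * d)| <= expR (- (2^-1 * w ^+ 2)).
Proof.
rewrite !normrM (ger0_norm (expR_ge0 _)).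
have -> : - (2^-1 * w ^+ 2) = w ^+ 2 / 2 - w ^+ 2 by lra.
rewrite expRD -[leRHS]mulr1; apply: ler_pM; rewrite ?mulr_ge0 ?expR_ge0//.
  by rewrite ler_wpM2r ?expR_ge0.
by rewrite ler_norml sin_geN1 sin_le1.
Qed.

Let integrable_F' d : mu.-integrable setT (EFin \o (fun w => w * expR (- w ^+ 2) * sin (w * d))).
Proof.
apply: (@integrable_gaussM 2^-1) => //.
apply: measurable_funM; last by apply: (measurableT_comp measurable_sin); exact: mulrr_measurable.
apply: measurable_funM => //.
by apply: measurableT_comp => //; exact: measurableT_comp.
Qed.

(** Integration by parts: the derivative of [e^{- w^2} sin (w d)] integrates to 0 and is [d] times
    the integrand of [F] minus twice the sine integrand that represents [- F']. *)
Let F_ode d : derive1 F d = - (d / 2) * F d.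
Proof.
rewrite (cvg_F d).2.
pose g w := expR (- w ^+ 2) * sin (w * d) : R.
pose g' w := d * (expR (- w ^+ 2) * cos (w * d)) - 2 * (w * expR (- w ^+ 2) * sin (w * d)) : R.
have : \int[mu]_w g' w = 0.
  (* The cosine term contributes [|d|] to the constant and the sine term 2, both against
     [e^{- w^2 / 2}]. *)
  apply: (@Rintegral_derive_eq0 g g' (`|d| + 2) 2^-1) => //.
  - by move=> x; rewrite /g; apply: is_derive_eq; rewrite /GRing.scale/= /g'; ring.
  - apply: (integrable_gaussM ltr01).
      apply: measurable_funM; last by apply: (measurableT_comp measurable_sin); exact: mulrr_measurable.
      by apply: measurableT_comp => //; exact: measurableT_comp.
    move=> w; rewrite mul1r normrM ger0_norm ?expR_ge0// ler_piMr ?expR_ge0//.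
    by rewrite ler_norml sin_geN1 sin_le1.
  - move=> x; rewrite /g' [leRHS]mulrDl (le_trans (ler_normB _ _))// lerD// normrM.
      rewrite ler_wpM2l// normrM ger0_norm ?expR_ge0//.
      have h : expR (- x ^+ 2) <= expR (- (2^-1 * x ^+ 2)) by rewrite ler_expR; have := sqr_ge0 x; lra.
      apply: le_trans h; rewrite ler_piMr ?expR_ge0//.
      by rewrite ler_norml cos_geN1 cos_le1.
    by rewrite (@ger0_norm _ 2)// ler_wpM2l// norm_wexpR_sin.
have i1 : mu.-integrable setT (EFin \o (fun w => d * (expR (- w ^+ 2) * cos (w * d)))).
  by apply: integrable_mull; exact: integrable_F.
have i2 : mu.-integrable setT (EFin \o (fun w => 2 * (w * expR (- w ^+ 2) * sin (w * d)))).
  by apply: integrable_mull; exact: integrable_F'.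
rewrite /g' RintegralB// !RintegralZl//.
rewrite -/(F d) => E.
under eq_Rintegral do rewrite -mulN1r.
rewrite RintegralZl//.
lra.
Qed.

(** By the differential equation, [F d] times [e^{d^2 / 4}] has zero derivative, and its value at 0
    is the Gaussian integral. *)
Let FE d : F d = Num.sqrt pi * expR (- (d ^+ 2 / 4)).
Proof.
have dF x : is_derive x 1 F (- (x / 2) * F x).
  by rewrite -F_ode derive1E; apply/derivableP; exact: (cvg_F x).1.
pose H x := F x * expR (x ^+ 2 / 4) : R.
have : H d = H 0.
  apply: is_derive_0_is_cst => x; rewrite /H; apply: is_derive_eq.
  by rewrite /GRing.scale/=; field.
rewrite /H expr0n/= mul0r expR0 mulr1.
have -> : F 0 = Num.sqrt pi.
  rewrite /F /Rintegral.
  under eq_integral do rewrite mulr0 cos0 mulr1.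
  by have := @integralT_gauss R; rewrite /gauss_fun => ->.
by move=> <-; rewrite -mulrA -expRD subrr expR0 mulr1.
Qed.

Lemma Rintegral_gauss_cos u d : 0 < u ->
  \int[mu]_w (expR (- (u * w ^+ 2)) * cos (w * d)) =
  Num.sqrt (pi / u) * expR (- (d ^+ 2 / (4 * u))).
Proof.
move=> u0; have su0 : 0 < Num.sqrt u by rewrite sqrtr_gt0.
have su2 : Num.sqrt u ^+ 2 = u by rewrite sqr_sqrtr// ltW.
have := Rintegral_affine 0 (lt0r_neq0 su0) (integrable_F (d / Num.sqrt u)).
under eq_Rintegral => w _.
  rewrite addr0 exprMn su2 (_ : Num.sqrt u * w * (d / Num.sqrt u) = w * d); last first.
    by field; rewrite gt_eqF.
  over.
move=> ->.
rewrite -/(F _) FE gtr0_norm// sqrtrM ?pi_ge0// sqrtrV ?ltW//.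
rewrite expr_div_n su2 mulrA [_ * Num.sqrt pi]mulrC; congr (_ * expR (- _)).
by field; rewrite gt_eqF.
Qed.

End Gaussian.

(** * The Gamma function *)

(* The truncation is needed because [t `^ y = 1] for t < 0. *)
Definition gamma_weight {R : realType} (x t : R) : R := if 0 < t then t `^ (x - 1) else 0.

Section GammaFunction.
Context {R : realType}.
Notation mu := (@lebesgue_measure R).
Implicit Types x t c : R.

Lemma gamma_weight_ge0 x t : 0 <= gamma_weight x t.
Proof. by rewrite /gamma_weight; case: ifP => // _; exact: powR_ge0. Qed.

Lemma measurable_gamma_weight x : measurable_fun setT (gamma_weight x).
Proof.
rewrite /gamma_weight; apply: measurable_fun_if => //.
- exact: measurable_fun_ltr.
- by apply: measurable_funTS; exact: measurable_powR.
Qed.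

Lemma gamma_weightZ x c t : 0 < c -> gamma_weight x (c * t) = c `^ (x - 1) * gamma_weight x t.
Proof.
move=> c0; rewrite /gamma_weight pmulr_rgt0//.
by case: ifPn => t0; rewrite ?mulr0// powRM// ltW.
Qed.

(** These intervals exhaust []0, 1]] and avoid the singularity at 0; the offset 2 keeps the left
    endpoint strictly below 1. *)
Let A n : set R := `[n.+2%:R^-1, 1]%classic.

(** On each [A n] the integrand has the primitive [t^x], so its integral is at most [1^x]; the bound
    passes to the increasing union. *)
Let powR_unit_interval x : 0 < x ->
  (\int[mu]_(t in \bigcup_n A n) (x * t `^ (x - 1))%R%:E <= 1)%E.
Proof.
move=> x0.
have A0 n : 0 < n.+2%:R^-1 :> R by rewrite invr_gt0.
have A1 n : n.+2%:R^-1 < 1 :> R by rewrite invf_lt1// ltr1n.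
have mA n : measurable (A n) by exact: measurable_itv.
have ndA : nondecreasing_seq A.
  apply/nondecreasing_seqP => n; rewrite subsetEset => t; rewrite /A/= !in_itv/= => /andP[h ->].
  by rewrite andbT (le_trans _ h)// lef_pV2 ?posrE// ler_nat.
have mf n : measurable_fun (A n) (fun t => (x * t `^ (x - 1))%:E).
  apply/measurable_EFinP/measurable_funTS/(measurable_funM (measurable_cst x)).
  exact: measurable_powR.
have f0 n t : A n t -> (0 <= (x * t `^ (x - 1))%:E)%E.
  by move=> _; rewrite lee_fin mulr_ge0 ?powR_ge0 ?ltW.
have /cvg_lim <- // := @ge0_nondecreasing_set_cvg_integral _ (measurableTypeR R) R A _ mu ndA mA mf f0.
apply: lime_le.
  apply: ereal_nondecreasing_is_cvgn.
  exact: (@ge0_nondecreasing_set_nondecreasing_integral _ (measurableTypeR R) R A _ mu ndA mA mf f0).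
apply: nearW => n.
have dP t : n.+2%:R^-1 <= t -> is_derive t 1 (@powR R ^~ x) (x * t `^ (x - 1)).
  by move=> h; exact: (@is_derive1_powR R x t (lt_le_trans (A0 n) h)).
have cP y t : n.+2%:R^-1 <= t -> {for t, continuous (fun t => t `^ y)}.
  move=> h; apply: differentiable_continuous; apply/derivable1_diffP.
  by apply: derivable_powR; rewrite in_itv/= andbT (lt_le_trans _ h).
rewrite (@continuous_FTC2 _ _ (@powR R ^~ x))//.
- rewrite powR1 -EFinB lee_fin lerBlDr lerDl powR_ge0//.
- apply: continuous_in_subspaceT => t; rewrite inE/= in_itv/= => /andP[h _].
  by apply: cvgM; [exact: cvg_cst|exact: cP].
- split.
  + by move=> t; rewrite in_itv/= => /andP[/ltW h _]; have [] := dP _ h.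
  + by apply: cvg_at_right_filter; exact: cP.
  + by apply: cvg_at_left_filter; apply: cP; exact/ltW/A1.
- move=> t; rewrite in_itv/= => /andP[/ltW h _].
  by rewrite derive1E; have [_ ->] := dP _ h.
Qed.

Let integrand x t := gamma_weight x t * expR (- t).

Let integrand_ge0 x t : 0 <= integrand x t.
Proof. by rewrite mulr_ge0 ?gamma_weight_ge0 ?expR_ge0. Qed.

Let measurable_integrand x : measurable_fun setT (integrand x).
Proof.
apply: measurable_funM; first exact: measurable_gamma_weight.
by apply: measurableT_comp => //; exact: measurableT_comp.
Qed.

(** Up to 1 the exponential is at most 1 and the power is integrable because [0 < x]. Beyond 1 the
    power is at most 1 because [x <= 1], and the exponential density dominates. *)
Let integrand_fin x : 0 < x <= 1 -> (\int[mu]_t (integrand x t)%:E < +oo)%E.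
Proof.
move=> /andP[x0 x1].
pose B := \bigcup_n A n.
have mA : measurable B by apply: bigcup_measurable => n _; exact: measurable_itv.
pose g t := (x * t `^ (x - 1))%:E.
have mg : measurable_fun setT (g \_ B).
  apply/(measurable_restrictT _ _).1 => //.
  apply/measurable_EFinP/measurable_funTS/(measurable_funM (measurable_cst x)).
  exact: measurable_powR.
have g0 t : (0 <= (g \_ B) t)%E.
  by rewrite patchE; case: ifP => // _; rewrite lee_fin mulr_ge0 ?powR_ge0 ?ltW.
pose e t := (exponential_pdf 1 t)%:E.
have me : measurable_fun setT e by apply/measurable_EFinP; exact: measurable_exponential_pdf.
have e0 t : (0 <= e t)%E by rewrite lee_fin exponential_pdf_ge0.
apply: (@le_lt_trans _ _ (\int[mu]_t (x^-1%:E * (g \_ B) t + e t))%E).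
  apply: ge0_le_integral => //.
  - by move=> t _; rewrite lee_fin.
  - by apply/measurable_EFinP; exact: measurable_integrand.
  - by apply: emeasurable_funD => //; exact: measurable_funeM.
  move=> t _; rewrite /integrand /gamma_weight.
  case: ifPn => t0; last first.
    by rewrite mul0r adde_ge0// mule_ge0// lee_fin invr_ge0 ltW.
  have [t1|t1] := leP t 1.
    have At : B t.
      have [n nt] : exists n : nat, t^-1 <= n.+2%:R.
        exists (Num.bound t^-1); rewrite (le_trans (ltW (archi_boundP _)))//.
          by rewrite invr_ge0 ltW.
        by rewrite ler_nat -addn2 leq_addr.
      exists n => //; rewrite /A/= in_itv/= t1 andbT.
      by rewrite -[leRHS]invrK lef_pV2// posrE ?invr_gt0.
    rewrite patchE mem_set// /g -EFinM mulKf ?gt_eqF//.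
    rewrite -[leLHS]adde0 leeD//.
    by rewrite lee_fin ler_piMr ?powR_ge0// -expR0 ler_expR oppr_le0 ltW.
  rewrite -[leLHS]add0e leeD//.
    by rewrite mule_ge0// lee_fin invr_ge0 ltW.
  rewrite /e exponential_pdfE ?(ltW t0)// mul1r mulN1r lee_fin ler_piMl ?expR_ge0//.
  by rewrite -[leRHS](powRr0 t) ler_powR ?(ltW t1)// subr_le0.
rewrite ge0_integralD//; last 2 first.
  - by move=> t _; rewrite mule_ge0// lee_fin invr_ge0 ltW.
  - exact: measurable_funeM.
rewrite integral_exponential_pdf// ge0_integralZl_EFin//; last by rewrite invr_ge0 ltW.
rewrite -integral_mkcond lte_add_pinfty ?ltry// lte_mul_pinfty ?lee_fin ?invr_ge0 ?ltW//.
exact: le_lt_trans (powR_unit_interval x0) (ltry _).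
Qed.

(** [Gamma] is the [fine] of an extended integral and would be 0 if that integral were infinite, so
    finiteness is the point here. *)
Lemma GammaE x : 0 < x <= 1 ->
  (\int[mu]_t (gamma_weight x t * expR (- t))%:E = (Gamma x)%:E)%E.
Proof.
move=> x01; rewrite /Gamma /Rintegral.
have -> : (\int[mu]_(t in `]0%R, +oo[) (t `^ (x - 1) * expR (- t))%:E =
    \int[mu]_t (integrand x t)%:E)%E.
  rewrite integral_mkcond; apply: eq_integral => t _.
  rewrite patchE /integrand /gamma_weight mem_setE in_itv/= andbT.
  by case: ifP => // _; rewrite mul0r.
by rewrite fineK// ge0_fin_numE ?integrand_fin// integral_ge0// => t _; rewrite lee_fin.
Qed.

Lemma Gamma_gt0 x : 0 < x <= 1 -> 0 < Gamma x.
Proof.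
move=> x01; rewrite -lte_fin -GammaE//.
(* As [x <= 1], both factors of the integrand decrease, so on [[1, 2]] the integrand is at least its
   value [k] at 2. *)
pose k := 2 `^ (x - 1) * expR (- 2) : R.
have k0 : 0 < k by rewrite mulr_gt0 ?powR_gt0 ?expR_gt0.
apply: (@lt_le_trans _ _ (\int[mu]_(t in `[1%R, 2%R]) k%:E)%E).
  rewrite integral_cst//= lebesgue_measure_itv/= lte_fin ltr1n/= -EFinB -EFinM lte_fin mulr_gt0//; lra.
apply: (@le_trans _ _ (\int[mu]_(t in `[1%R, 2%R]) (integrand x t)%:E)%E).
  apply: ge0_le_integral => //.
  - by move=> t _; rewrite lee_fin ltW.
  - apply/measurable_EFinP; apply/measurable_funTS; exact: measurable_integrand.
  - move=> t /=; rewrite in_itv/= => /andP[t1 t2].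
    have t0 : 0 < t by exact: lt_le_trans t1.
    rewrite lee_fin /integrand /gamma_weight t0 ler_pM ?powR_ge0 ?expR_ge0//.
      rewrite -(opprB 1) !powRN lef_pV2 ?posrE ?powR_gt0//.
      case/andP: x01 => _; rewrite -subr_ge0 => x1.
      by apply: (ge0_ler_powR x1 _ _ t2); [exact: (ltW t0)|exact: ler0n].
    by rewrite ler_expR lerN2.
apply: ge0_subset_integral => //; first by apply/measurable_EFinP; exact: measurable_integrand.
by move=> t _; rewrite lee_fin.
Qed.

(** Substitute [c t] for [t] and use the homogeneity of the weight. With [c] the square of a
    variable, this writes a power weight as a mixture of Gaussians. *)
Lemma integral_gamma_weight x c : 0 < x <= 1 -> 0 < c ->
  (\int[mu]_t (gamma_weight x t * expR (- (c * t)))%:E = (c `^ (- x) * Gamma x)%:E)%E.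
Proof.
move=> x01 c0.
have mi : measurable_fun setT (EFin \o integrand x).
  by apply/measurable_EFinP; exact: measurable_integrand.
have i0 t : (0 <= (EFin \o integrand x) t)%E by rewrite lee_fin.
have := ge0_integral_affine 0 (lt0r_neq0 c0) mi i0; rewrite (GammaE x01) => E.
have {}E : (\int[mu]_t ((c `^ (x - 1))%:E * (gamma_weight x t * expR (- (c * t)))%:E) =
    `|c|^-1%:E * (Gamma x)%:E)%E.
  rewrite -E; apply: eq_integral => t _.
  by rewrite /= addr0 /integrand gamma_weightZ// -EFinM mulrA.
rewrite ge0_integralZl_EFin ?powR_ge0// in E; last 2 first.
  - by move=> t _; rewrite lee_fin mulr_ge0 ?gamma_weight_ge0 ?expR_ge0.
  - apply/measurable_EFinP; apply: measurable_funM; first exact: measurable_gamma_weight.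
    by apply: measurableT_comp => //; apply: measurableT_comp => //.
have cx0 : 0 < c `^ (x - 1) by rewrite powR_gt0.
rewrite -[LHS]mul1e -(mulVf (lt0r_neq0 cx0)) EFinM -muleA E -!EFinM gtr0_norm//.
congr EFin; rewrite mulrA -powRN -powR_inv1 ?ltW// -powRD; last by rewrite (gt_eqF c0) implybT.
by congr (_ `^ _ * _); lra.
Qed.

End GammaFunction.

(** * Tonelli, Beta and Riesz integrals *)

Ltac measurability_step :=
  match goal with
  | |- _ => exact: measurable_cst
  | |- _ => exact: measurable_id
  | |- _ => exact: measurable_fst
  | |- _ => exact: measurable_snd
  | |- _ => assumption
  | H : measurable_fun setT ?f |- measurable_fun setT (fun z => ?f _) =>
      apply: (measurableT_comp H)
  | |- measurable_fun _ (fun z => expR _) => apply: (measurableT_comp (@measurable_expR _))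
  | |- measurable_fun _ (fun z => cos _) => apply: (measurableT_comp (@measurable_cos _))
  | |- measurable_fun _ (fun z => sin _) => apply: (measurableT_comp (@measurable_sin _))
  | |- measurable_fun _ (fun z => gamma_weight _ _) =>
      apply: (measurableT_comp (@measurable_gamma_weight _ _))
  | |- measurable_fun _ (fun z => _ `^ _) => apply: (measurableT_comp (@measurable_powR _ _))
  | |- measurable_fun _ (fun z => `|_|) => apply: (measurableT_comp (@normr_measurable _ setT))
  | |- measurable_fun _ (fun z => _ + _) => apply: measurable_funD
  | |- measurable_fun _ (fun z => _ * _) => apply: measurable_funM
  | |- measurable_fun _ (fun z => - _) => apply: measurable_funN
  | |- measurable_fun _ (fun z => _ ^+ _) => apply: measurable_funX
  | |- _ => exact: measurable_gamma_weight
  | |- _ => apply: measurable_funD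
  | |- _ => apply: measurable_funM
  end.
Ltac measurability := repeat measurability_step.

Section NonnegativeIntegrals.
Context {R : realType}.
Notation mu := (@lebesgue_measure R).

Lemma ge0_integral_mull (k : R) (f : R -> R) : 0 <= k -> measurable_fun setT f ->
  (forall x, 0 <= f x) ->
  (\int[mu]_x (k * f x)%:E = k%:E * \int[mu]_x (f x)%:E)%E.
Proof.
move=> k0 mf f0; rewrite -ge0_integralZl_EFin//.
- by move=> x _; rewrite lee_fin.
- exact/measurable_EFinP.
Qed.

Lemma tonelli (f : R -> R -> R) : measurable_fun setT (fun z : R * R => f z.1 z.2) ->
  (forall x y, 0 <= f x y) ->
  (\int[mu]_x \int[mu]_y (f x y)%:E = \int[mu]_y \int[mu]_x (f x y)%:E)%E.
Proof.
move=> mf f0.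
apply: (@fubini_tonelli _ _ _ _ _ mu mu (fun z => (f z.1 z.2)%:E)).
  exact/measurable_EFinP.
by move=> z; rewrite lee_fin.
Qed.

Lemma measurable_fun1 (f : R -> R -> R) x : measurable_fun setT (fun z : R * R => f z.1 z.2) ->
  measurable_fun setT (f x).
Proof. by move=> mf; apply: (measurableT_comp mf (pair1_measurable x)). Qed.

Lemma measurable_fun2 (f : R -> R -> R) y : measurable_fun setT (fun z : R * R => f z.1 z.2) ->
  measurable_fun setT (f ^~ y).
Proof. by move=> mf; apply: (measurableT_comp mf (pair2_measurable y)). Qed.

Lemma measurable_swapped (f : R -> R -> R) : measurable_fun setT (fun z : R * R => f z.1 z.2) ->
  measurable_fun setT (fun z : R * R => f z.2 z.1).
Proof.
move=> mf; pose s (z : R * R) := (z.2, z.1).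
have ms : measurable_fun setT s by apply: measurable_fun_pair.
exact: (measurableT_comp mf ms).
Qed.

End NonnegativeIntegrals.

Section BetaIntegrals.
Context {R : realType}.
Notation mu := (@lebesgue_measure R).
Implicit Types a c x : R.

Lemma gamma_weightMpowR a c (t : R) :
  gamma_weight c t * t `^ (- a) = gamma_weight (c - a) t.
Proof.
rewrite /gamma_weight; case: ifPn => t0; last by rewrite mul0r.
rewrite -powRD; last by rewrite (gt_eqF t0) implybT.
by congr (_ `^ _); lra.
Qed.

(** The integral is the Beta function [B(a, c - a)]. Writing [Gamma(c) (1 + k)^{- c}] as the
    integral of [r^{c - 1} e^{- (1 + k) r}] and exchanging, the [k]-integral gives
    [Gamma(a) r^{- a}], and the [r]-integral is then [Gamma(c - a)]. *)
Lemma beta_integral a c : 0 < a <= 1 -> 0 < c <= 1 -> 0 < c - a ->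
  ((Gamma c)%:E * \int[mu]_k (gamma_weight a k * (1 + k) `^ (- c))%:E =
   (Gamma a * Gamma (c - a))%:E)%E.
Proof.
move=> a01 c01 ca0.
have ca01 : 0 < c - a <= 1 by rewrite ca0; lra.
pose f k r := gamma_weight a k * (gamma_weight c r * expR (- ((1 + k) * r))) : R.
have f0 k r : 0 <= f k r by rewrite !mulr_ge0 ?gamma_weight_ge0 ?expR_ge0.
have mf : measurable_fun setT (fun z : R * R => f z.1 z.2).
  by rewrite /f; measurability.
transitivity (\int[mu]_k \int[mu]_r (f k r)%:E)%E.
  rewrite -ge0_integral_mull ?ltW ?Gamma_gt0//; last 2 first.
    by measurability.
    by move=> k; rewrite mulr_ge0 ?gamma_weight_ge0 ?powR_ge0.
  apply: eq_integral => k _; rewrite ge0_integral_mull ?gamma_weight_ge0//; last 2 first.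
    by measurability.
    by move=> r; rewrite mulr_ge0 ?gamma_weight_ge0 ?expR_ge0.
  (* For [k <= 0] the base [1 + k] may fail to be positive, but the weight in [k] vanishes there. *)
  have [k0|k0] := ltP 0 k; last by rewrite /gamma_weight ltNge k0/= mul0r mulr0 mul0e.
  rewrite integral_gamma_weight// ?addr_gt0//.
  by rewrite -EFinM; congr EFin; ring.
rewrite tonelli//.
transitivity (\int[mu]_r (Gamma a * (gamma_weight (c - a) r * expR (- r)))%:E)%E.
  apply: eq_integral => r _.
  transitivity (\int[mu]_k (gamma_weight c r * expR (- r) * (gamma_weight a k * expR (- (r * k))))%:E)%E.
    apply: eq_integral => k _; congr EFin; rewrite /f.
    rewrite (_ : - ((1 + k) * r) = - r + - (r * k)); last by ring.
    by rewrite expRD; ring.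
  rewrite ge0_integral_mull ?mulr_ge0 ?gamma_weight_ge0 ?expR_ge0//; last 2 first.
    by measurability.
    by move=> k; rewrite mulr_ge0 ?gamma_weight_ge0 ?expR_ge0.
  have [r0|r0] := ltP 0 r; last by rewrite /gamma_weight ltNge r0/= !mul0r mulr0 mul0e.
  rewrite integral_gamma_weight// -EFinM -gamma_weightMpowR; congr EFin; ring.
rewrite ge0_integral_mull ?ltW ?Gamma_gt0//; last 2 first.
  by measurability.
  by move=> r; rewrite mulr_ge0 ?gamma_weight_ge0 ?expR_ge0.
by rewrite GammaE// EFinM.
Qed.

(** For fixed [v], the substitution [k = 4 u v] separates the variables: what remains in [v] is a
    Gamma integral with rate [X / (1 + k)]. It is applied with [X = x^2]. *)
Lemma riesz_integral a c (X : R) : 0 < a <= 1 -> 0 < c - a <= 1 -> 0 < X ->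
  (\int[mu]_u \int[mu]_v (gamma_weight a u * (gamma_weight c v *
      ((1 + 4 * u * v) `^ (- 2^-1) * expR (- (v * X * (1 + 4 * u * v) `^ (-1))))))%:E =
  (4 `^ (- a) * Gamma (c - a) * X `^ (- (c - a)))%:E *
     \int[mu]_k (gamma_weight a k * (1 + k) `^ (c - a - 2^-1))%:E)%E.
Proof.
move=> a01 ca01 X0.
rewrite (@tonelli R (fun u v => gamma_weight a u * (gamma_weight c v *
  ((1 + 4 * u * v) `^ (- 2^-1) * expR (- (v * X * (1 + 4 * u * v) `^ (-1))))))); last 2 first.
  by measurability.
  by move=> u v; rewrite !mulr_ge0 ?gamma_weight_ge0 ?powR_ge0 ?expR_ge0.
(* The integrand after the substitution: [u^{a - 1} du] becomes [(4 v)^{- a} k^{a - 1} dk], and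
   [v^{- a}] lowers the index [c] of the other weight to [c - a]. *)
pose g k v := gamma_weight a k * (4 `^ (- a) * (1 + k) `^ (- 2^-1)) *
   (gamma_weight (c - a) v * expR (- (X * (1 + k) `^ (-1) * v))) : R.
have g0 k v : 0 <= g k v by rewrite !mulr_ge0 ?gamma_weight_ge0 ?expR_ge0 ?powR_ge0.
have mg : measurable_fun setT (fun z : R * R => g z.1 z.2).
  by rewrite /g; measurability.
transitivity (\int[mu]_v \int[mu]_k (g k v)%:E)%E.
  apply: eq_integral => v _.
  have [v0|v0] := ltP 0 v; last first.
    by rewrite /g /gamma_weight [0 < v]ltNge v0/=; apply: eq_integral => k _; congr EFin; ring.
  have v40 : 0 < 4 * v by rewrite mulr_gt0.
  have mgv : measurable_fun setT (fun k => (4 * v) * g k v).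
    by apply: measurable_funM => //; exact: measurable_fun2 mg.
  have gv0 k : 0 <= (4 * v) * g k v by rewrite mulr_ge0// ltW.
  transitivity (`|4 * v|^-1%:E * \int[mu]_k ((4 * v) * g k v)%:E)%E; last first.
    rewrite -ge0_integral_mull ?invr_ge0//; apply: eq_integral => k _.
    by rewrite gtr0_norm// mulKf// gt_eqF.
  rewrite -(@ge0_integral_affine R (4 * v) 0 (fun k => ((4 * v) * g k v)%:E)); last 3 first.
    exact: lt0r_neq0.
    exact/measurable_EFinP.
    by move=> k; rewrite lee_fin.
  apply: eq_integral => u _; congr EFin.
  rewrite /g addr0 gamma_weightZ// -gamma_weightMpowR.
  rewrite (_ : 4 * v * u = 4 * u * v); last by ring.
  rewrite (_ : X * (1 + 4 * u * v) `^ (-1) * v = v * X * (1 + 4 * u * v) `^ (-1)); last by ring.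
  have -> : (4 * v) `^ (a - 1) = 4 `^ a * v `^ a * (4 * v)^-1.
    by rewrite -powRM ?ltW// -powR_inv1 ?ltW// -powRD// (gt_eqF v40) implybT.
  have e1 : 4 `^ a * 4 `^ (- a) = 1 :> R by rewrite powRN divff// gt_eqF// powR_gt0.
  have e2 : v `^ a * v `^ (- a) = 1 by rewrite powRN divff// gt_eqF// powR_gt0.
  have e3 : 4 * v * (4 * v)^-1 = 1 by rewrite divff// gt_eqF.
  transitivity ((4 `^ a * 4 `^ (- a)) * (v `^ a * v `^ (- a)) * (4 * v * (4 * v)^-1) *
    (gamma_weight a u * (gamma_weight c v * ((1 + 4 * u * v) `^ (- 2^-1) * expR (- (v * X * (1 + 4 * u * v) `^ (-1))))))).
    by rewrite e1 e2 e3 !mul1r.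
  by ring.
rewrite -tonelli//.
have h0 : 0 <= 4 `^ (- a) * Gamma (c - a) * X `^ (- (c - a)).
  by rewrite !mulr_ge0 ?powR_ge0// ltW// Gamma_gt0.
rewrite -ge0_integral_mull//; last 2 first.
  by measurability.
  by move=> k; rewrite mulr_ge0 ?gamma_weight_ge0 ?powR_ge0.
apply: eq_integral => k _.
rewrite ge0_integral_mull//; last 3 first.
  by rewrite !mulr_ge0 ?gamma_weight_ge0 ?powR_ge0.
  by measurability.
  by move=> v; rewrite mulr_ge0 ?gamma_weight_ge0 ?expR_ge0.
have [k0|k0] := ltP 0 k; last first.
  by rewrite /gamma_weight [0 < k]ltNge k0/= !mul0r mulr0 mul0e.
have k10 : 0 < 1 + k by rewrite addr_gt0.
rewrite integral_gamma_weight ?mulr_gt0 ?powR_gt0// -EFinM; congr EFin.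
rewrite powRM ?powR_ge0 ?ltW// -powRrM mulN1r opprK.
rewrite [c - a - _]addrC (@powRD _ (1 + k) (- 2^-1)); last by rewrite (gt_eqF k10) implybT.
by ring.
Qed.

End BetaIntegrals.

(** * Fubini for bounded kernels *)

Section BoundedKernels.
Context {R : realType}.
Notation mu := (@lebesgue_measure R).
Implicit Types (A B p : R -> R) (m : R -> R -> R).

Lemma measurable_integrable p : mu.-integrable setT (EFin \o p) -> measurable_fun setT p.
Proof. by move=> ip; apply/measurable_EFinP; exact: measurable_int ip. Qed.

Lemma integrable_mul_bounded (K : R) p (h : R -> R) :
  mu.-integrable setT (EFin \o p) -> measurable_fun setT h -> (forall x, `|h x| <= K) ->
  mu.-integrable setT (EFin \o (fun x => p x * h x)).
Proof.
move=> ip mh hK; have mp := measurable_integrable ip.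
apply: (le_integrable _ _ _ (integrable_mull K ip)) => //.
  by apply/measurable_EFinP; measurability.
move=> x _ /=; rewrite lee_fin !normrM mulrC ler_wpM2r//.
by rewrite (le_trans (hK x))// ler_norm.
Qed.

Lemma measurable_tonelli m : measurable_fun setT (fun z : R * R => m z.1 z.2) ->
  (forall x y, 0 <= m x y) -> measurable_fun setT (fun x => \int[mu]_y (m x y)%:E)%E.
Proof.
move=> mm m0.
apply: (@measurable_fun_fubini_tonelli_F _ _ _ _ _ mu (fun z : R * R => (m z.1 z.2)%:E)).
  exact/measurable_EFinP.
by move=> z; rewrite lee_fin.
Qed.

(** The inner integral is [fine] of a difference of two nonnegative integrals, each measurable in
    [x] by Tonelli. *)
Lemma measurable_Rintegral m : measurable_fun setT (fun z : R * R => m z.1 z.2) ->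
  measurable_fun setT (fun x => \int[mu]_y m x y).
Proof.
move=> mm; pose f := fun z : R * R => (m z.1 z.2)%:E.
have mf : measurable_fun setT f by exact/measurable_EFinP.
apply: (measurableT_comp (fine_measurable measurableT)).
have -> : (fun x => \int[mu]_y (m x y)%:E)%E =
    (fun x => \int[mu]_y (f^\+ (x, y)) - \int[mu]_y (f^\- (x, y)))%E.
  apply/funext => x; rewrite integralE; congr (_ - _)%E; apply: eq_integral => y _.
    by rewrite !funeposE.
  by rewrite !funenegE.
apply: emeasurable_funB.
  exact: (@measurable_fun_fubini_tonelli_F _ _ _ _ _ mu (f^\+)%E (measurable_funepos mf) (fun z => funepos_ge0 f z)).
exact: (@measurable_fun_fubini_tonelli_F _ _ _ _ _ mu (f^\-)%E (measurable_funeneg mf) (fun z => funeneg_ge0 f z)).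
Qed.

Lemma Rintegral_bounded (K : R) p (h : R -> R) :
  mu.-integrable setT (EFin \o p) -> measurable_fun setT h -> (forall x, `|h x| <= K) ->
  `|\int[mu]_x (p x * h x)| <= (\int[mu]_x `|p x|) * K.
Proof.
move=> ip mh hK; have iph := integrable_mul_bounded ip mh hK.
apply: (le_trans (le_normr_Rintegral measurableT iph)).
have ip' : mu.-integrable setT (EFin \o (fun x => `|p x|)).
  by have := integrable_norm ip.
rewrite -RintegralZr//; apply: le_Rintegral => //.
- by have := integrable_norm iph.
- by have := integrable_mull K ip'; apply: eq_integrable => // x _ /=; rewrite mulrC.
- by move=> x _; rewrite normrM ler_wpM2l.
Qed.

Lemma integrable_kernel (K : R) A B m :
  mu.-integrable setT (EFin \o A) -> mu.-integrable setT (EFin \o B) ->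
  measurable_fun setT (fun z : R * R => m z.1 z.2) -> (forall x y, `|m x y| <= K) ->
  (mu \x mu)%E.-integrable setT (fun z => (A z.1 * B z.2 * m z.1 z.2)%:E).
Proof.
move=> iA iB mm mK; have mA := measurable_integrable iA; have mB := measurable_integrable iB.
have K0 : 0 <= K by exact: le_trans (mK 0 0).
apply/(integrable12ltyP _ _ _).2.
  by apply/measurable_EFinP; measurability.
have iB' : (\int[mu]_y `|B y|%:E < +oo)%E by move/integrableP : iB => [_].
have iA' : (\int[mu]_y `|A y|%:E < +oo)%E by move/integrableP : iA => [_].
apply: (@le_lt_trans _ _ (\int[mu]_x \int[mu]_y (`|A x| * K * `|B y|)%:E)%E).
  apply: ge0_le_integral => //.
  - by move=> x _; exact: integral_ge0.
  - by apply: (@measurable_tonelli (fun x y => `|A x * B y * m x y|)) => //; measurability.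
  - apply: (@measurable_tonelli (fun x y => `|A x| * K * `|B y|)) => //; first by measurability.
    by move=> x y; rewrite !mulr_ge0.
  move=> x _; apply: ge0_le_integral => //.
  - by apply/measurable_EFinP; have := measurable_fun1 x mm => mx; measurability.
  - by apply/measurable_EFinP; measurability.
  move=> y _; rewrite lee_fin !normrM -!mulrA ler_wpM2l// mulrC ler_wpM2r//.
under eq_integral => x _.
  rewrite ge0_integral_mull ?mulr_ge0//; last by measurability.
  over.
rewrite ge0_integralZr//; last 3 first.
  by apply/measurable_EFinP; measurability.
  by move=> x _; rewrite lee_fin mulr_ge0.
  by apply: integral_ge0.
rewrite (_ : (fun x => (`|A x| * K)%:E) = (fun x => (K * `|A x|)%:E)); last first.
  by apply/funext => x; rewrite mulrC.
rewrite ge0_integral_mull//; last by measurability.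
rewrite lte_mul_pinfty//.
- by rewrite mule_ge0// integral_ge0.
- rewrite fin_numM// ge0_fin_numE//; exact: integral_ge0.
Qed.

(** The integrand on the plane is dominated by [K |A x| |B y|]. The kernels to which this applies
    are trigonometric, hence bounded without decaying. *)
Lemma fubini_kernel (K : R) A B m :
  mu.-integrable setT (EFin \o A) -> mu.-integrable setT (EFin \o B) ->
  measurable_fun setT (fun z : R * R => m z.1 z.2) -> (forall x y, `|m x y| <= K) ->
  \int[mu]_x (A x * \int[mu]_y (B y * m x y)) =
  \int[mu]_y (B y * \int[mu]_x (A x * m x y)).
Proof.
move=> iA iB mm mK; have mA := measurable_integrable iA; have mB := measurable_integrable iB.
have iK := integrable_kernel iA iB mm mK.
(* Fubini is stated for extended integrals; [eB] and [eA] carry the real inner integrals there,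
   where integrability makes them finite. *)
have eB x : (\int[mu]_y (A x * B y * m x y)%:E)%E = (A x * \int[mu]_y (B y * m x y))%:E.
  have ix : mu.-integrable setT (EFin \o (fun y => B y * m x y)).
    exact: (integrable_mul_bounded iB (measurable_fun1 x mm) (mK x)).
  rewrite -RintegralZl// /Rintegral fineK.
    by apply: eq_integral => y _; rewrite mulrA.
  exact: (integrable_fin_num measurableT (integrable_mull (A x) ix)).
have eA y : (\int[mu]_x (A x * B y * m x y)%:E)%E = (B y * \int[mu]_x (A x * m x y))%:E.
  have iy : mu.-integrable setT (EFin \o (fun x => A x * m x y)).
    exact: (integrable_mul_bounded iA (measurable_fun2 y mm) (fun x => mK x y)).
  rewrite -RintegralZl// /Rintegral fineK.
    by apply: eq_integral => x _; rewrite mulrA [B y * _]mulrC.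
  exact: (integrable_fin_num measurableT (integrable_mull (B y) iy)).
rewrite /Rintegral; congr fine.
under eq_integral do rewrite -eB.
under [RHS]eq_integral do rewrite -eA.
exact: (Fubini iK).
Qed.

End BoundedKernels.

(** * Cosine and sine transforms *)

Section TrigonometricTransforms.
Context {R : realType}.
Notation mu := (@lebesgue_measure R).
Implicit Types (p : R -> R) (u w : R).

Definition cos_transform p w := \int[mu]_t (p t * cos (w * t)).
Definition sin_transform p w := \int[mu]_t (p t * sin (w * t)).
(** The squared modulus of the Fourier transform of the real function [p]. *)
Definition spectrum p w := cos_transform p w ^+ 2 + sin_transform p w ^+ 2.

Lemma norm_cos_le1 (x : R) : `|cos x| <= 1.
Proof. by rewrite ler_norml cos_geN1 cos_le1. Qed.

Lemma norm_sin_le1 (x : R) : `|sin x| <= 1.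
Proof. by rewrite ler_norml sin_geN1 sin_le1. Qed.

Lemma spectrum_ge0 p w : 0 <= spectrum p w.
Proof. by rewrite addr_ge0 ?sqr_ge0. Qed.

Lemma measurable_cos_transform p : measurable_fun setT p ->
  measurable_fun setT (cos_transform p).
Proof.
by move=> mp; apply: (@measurable_Rintegral _ (fun w t => p t * cos (w * t))); measurability.
Qed.

Lemma measurable_sin_transform p : measurable_fun setT p ->
  measurable_fun setT (sin_transform p).
Proof.
by move=> mp; apply: (@measurable_Rintegral _ (fun w t => p t * sin (w * t))); measurability.
Qed.

Lemma measurable_spectrum p : measurable_fun setT p -> measurable_fun setT (spectrum p).
Proof.
move=> mp; apply: measurable_funD; apply: measurable_funX.
  exact: measurable_cos_transform.
exact: measurable_sin_transform.
Qed.

Lemma integrable_mul_cos p w : mu.-integrable setT (EFin \o p) ->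
  mu.-integrable setT (EFin \o (fun t => p t * cos (w * t))).
Proof.
move=> ip; apply: (@integrable_mul_bounded _ 1) => //; first by measurability.
by move=> x; exact: norm_cos_le1.
Qed.

Lemma integrable_mul_sin p w : mu.-integrable setT (EFin \o p) ->
  mu.-integrable setT (EFin \o (fun t => p t * sin (w * t))).
Proof.
move=> ip; apply: (@integrable_mul_bounded _ 1) => //; first by measurability.
by move=> x; exact: norm_sin_le1.
Qed.

(** The inner integral in the expansion of the squared modulus as the double integral of
    [p x p y cos (w (x - y))]. *)
Let D p w x := \int[mu]_y (p y * cos (w * (x - y))).

Let DE p w x : mu.-integrable setT (EFin \o p) ->
  D p w x = cos (w * x) * cos_transform p w + sin (w * x) * sin_transform p w.
Proof.
move=> ip; rewrite /cos_transform /sin_transform.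
rewrite -!RintegralZl//; [|exact: integrable_mul_sin|exact: integrable_mul_cos].
rewrite -RintegralD//; last 2 first.
  by apply: integrable_mull; exact: integrable_mul_cos.
  by apply: integrable_mull; exact: integrable_mul_sin.
by apply: eq_Rintegral => y _; rewrite mulrBr cosB; ring.
Qed.

Let spectrumE p w : mu.-integrable setT (EFin \o p) ->
  spectrum p w = \int[mu]_x (p x * D p w x).
Proof.
move=> ip.
rewrite /spectrum !expr2 -[in X in X + _]RintegralZr; [|by []|exact: integrable_mul_cos].
rewrite -[in X in _ + X]RintegralZr; [|by []|exact: integrable_mul_sin].
rewrite -RintegralD//; last 2 first.
  have := integrable_mull (cos_transform p w) (integrable_mul_cos w ip).
  by apply: eq_integrable => // x _ /=; rewrite mulrC.
  have := integrable_mull (sin_transform p w) (integrable_mul_sin w ip).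
  by apply: eq_integrable => // x _ /=; rewrite mulrC.
by apply: eq_Rintegral => x _; rewrite DE//; ring.
Qed.

Let norm_D p w x : mu.-integrable setT (EFin \o p) ->
  `|D p w x| <= (\int[mu]_t `|p t|) * 1.
Proof.
move=> ip; apply: Rintegral_bounded => //; first by measurability.
by move=> y; exact: norm_cos_le1.
Qed.

(** Expand the spectrum as a double integral and integrate in [w] first, which produces the Fourier
    transform of the Gaussian at [x - y]. Absolute values come last, to prepare for the Schur
    test. *)
Lemma spectrum_gauss p u : mu.-integrable setT (EFin \o p) -> 0 < u ->
  (\int[mu]_w (expR (- (u * w ^+ 2)) * spectrum p w)%:E <=
   \int[mu]_x \int[mu]_y (Num.sqrt (pi / u) *
     (`|p x| * `|p y| * expR (- ((x - y) ^+ 2 / (4 * u)))))%:E)%E.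
Proof.
move=> ip u0; have mp := measurable_integrable ip.
pose G w := expR (- (u * w ^+ 2)).
have iG : mu.-integrable setT (EFin \o G) by exact: integrable_gauss.
have mG : measurable_fun setT G by exact: measurable_integrable.
pose k x y := Num.sqrt (pi / u) * expR (- ((x - y) ^+ 2 / (4 * u))).
have k0 x y : 0 <= k x y by rewrite mulr_ge0 ?sqrtr_ge0 ?expR_ge0.
have mk : measurable_fun setT (fun z : R * R => k z.1 z.2).
  by rewrite /k; measurability.
have kK x y : `|k x y| <= Num.sqrt (pi / u).
  rewrite ger0_norm// ler_piMr ?sqrtr_ge0// -expR0 ler_expR oppr_le0.
  by rewrite mulr_ge0 ?sqr_ge0// invr_ge0 mulr_ge0// ltW.
have mD : measurable_fun setT (fun z : R * R => D p z.1 z.2).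
  under eq_fun do rewrite DE//.
  have mc := measurable_cos_transform mp.
  have ms := measurable_sin_transform mp.
  by measurability.
have mspec := measurable_spectrum mp.
pose N x := \int[mu]_y (p y * k x y).
have E : \int[mu]_w (G w * spectrum p w) = \int[mu]_x (p x * N x).
  under eq_Rintegral do rewrite spectrumE//.
  (* Two exchanges, of [w] with [x] and then of [w] with [y], bring the [w]-integral innermost. *)
  rewrite (@fubini_kernel _ _ G p (fun w x => D p w x) iG ip mD (fun w x => norm_D w x ip)).
  apply: eq_Rintegral => x _; congr (_ * _).
  rewrite (@fubini_kernel _ 1 G p (fun w y => cos (w * (x - y))) iG ip); last 2 first.
    by measurability.
    by move=> w y; exact: norm_cos_le1.
  by apply: eq_Rintegral => y _; rewrite Rintegral_gauss_cos.
have specK w : `|spectrum p w| <= ((\int[mu]_t `|p t|) * (\int[mu]_t `|p t| * 1)).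
  rewrite spectrumE//; apply: Rintegral_bounded => //; last by move=> x; exact: norm_D.
  exact: (@measurable_fun1 _ (D p) w mD).
have iGs := integrable_mul_bounded iG mspec specK.
have -> : (\int[mu]_w (G w * spectrum p w)%:E)%E = (\int[mu]_x (p x * N x))%:E.
  by rewrite -E /Rintegral fineK//; exact: (integrable_fin_num measurableT iGs).
have mN : measurable_fun setT N.
  by apply: (@measurable_Rintegral _ (fun x y => p y * k x y)); measurability.
have NK x : `|N x| <= (\int[mu]_t `|p t|) * Num.sqrt (pi / u).
  by apply: Rintegral_bounded => //; exact: measurable_fun1.
have ipN := integrable_mul_bounded ip mN NK.
have ipk x : mu.-integrable setT (EFin \o (fun y => p y * k x y)).
  exact: (integrable_mul_bounded ip (measurable_fun1 x mk) (kK x)).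
rewrite (le_trans (_ : _ <= `|\int[mu]_x (p x * N x)|%:E)%E)//.
  by rewrite lee_fin ler_norm.
rewrite EFin_normr_Rintegral//.
apply: (le_trans (le_abse_integral _ _ _)) => //.
  by apply/measurable_EFinP; measurability.
apply: ge0_le_integral => //.
- by apply/measurable_EFinP; measurability.
- apply: (@measurable_tonelli _ (fun x y => Num.sqrt (pi / u) *
     (`|p x| * `|p y| * expR (- ((x - y) ^+ 2 / (4 * u)))))).
    by measurability.
  by move=> x y; rewrite !mulr_ge0 ?sqrtr_ge0 ?expR_ge0.
move=> x _.
have -> : (\int[mu]_y (Num.sqrt (pi / u) * (`|p x| * `|p y| * expR (- ((x - y) ^+ 2 / (4 * u)))))%:E)%E
  = (`|p x|%:E * \int[mu]_y `|p y * k x y|%:E)%E.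
  have mkx := measurable_fun1 x mk.
  rewrite -ge0_integral_mull//; last by measurability.
  apply: eq_integral => y _; congr EFin.
  by rewrite normrM (ger0_norm (k0 _ _)) /k; ring.
rewrite EFinM abseM lee_wpmul2l//= EFin_normr_Rintegral//.
by apply: le_abse_integral => //; exact: measurable_int (ipk x).
Qed.

End TrigonometricTransforms.

(** * Schur test with power weights *)

Section SchurTest.
Context {R : realType}.
Notation mu := (@lebesgue_measure R).
Implicit Types (p h : R -> R) (u v w x y a c : R).

(** The pointwise bound has two halves that are exchanged by swapping [x] and [y]; symmetry of [K]
    and Tonelli make their integrals equal. Here [h'] plays the inverse of [h] wherever [p] is
    nonzero. *)
Lemma schur_test (K : R -> R -> R) p h h' :
  measurable_fun setT (fun z : R * R => K z.1 z.2) -> (forall x y, 0 <= K x y) ->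
  (forall x y, K x y = K y x) ->
  measurable_fun setT p -> measurable_fun setT h -> measurable_fun setT h' ->
  (forall x, 0 <= h x) -> (forall x, 0 <= h' x) ->
  (forall x, p x != 0 -> h x * h' x = 1) ->
  (\int[mu]_x \int[mu]_y (K x y * (`|p x| * `|p y|))%:E <=
   \int[mu]_x \int[mu]_y (K x y * (p x ^+ 2 * h x * h' y))%:E)%E.
Proof.
move=> mK K0 Ksym mp mh mh' h0 h'0 hh'.
pose f x y := 2^-1 * (K x y * (p x ^+ 2 * h x * h' y)).
have f0 x y : 0 <= f x y.
  by rewrite /f; do 4 apply: mulr_ge0 => //; exact: sqr_ge0.
have mf : measurable_fun setT (fun z : R * R => f z.1 z.2) by rewrite /f; measurability.
have mft : measurable_fun setT (fun z : R * R => f z.2 z.1).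
  exact: measurable_swapped.
(* AM-GM, the two products of weights being inverse to each other *)
have amgm x y : K x y * (`|p x| * `|p y|) <= f x y + f y x.
  have [px0|px0] := eqVneq (p x) 0; first by rewrite px0 normr0 mul0r mulr0 addr_ge0.
  have [py0|py0] := eqVneq (p y) 0; first by rewrite py0 normr0 !mulr0 addr_ge0.
  rewrite /f (Ksym y x) -mulrDr -mulrDr [leRHS]mulrCA ler_wpM2l// ler_pdivlMl//.
  set H := h x * h' y; set H' := h y * h' x.
  have HH' : H * H' = 1.
    transitivity ((h x * h' x) * (h y * h' y)); first by rewrite /H /H'; ring.
    by rewrite !hh'// mulr1.
  have H0 : 0 <= H by rewrite mulr_ge0.
  have H'0 : 0 <= H' by rewrite mulr_ge0.
  have -> : p x ^+ 2 * h x * h' y + p y ^+ 2 * h y * h' x =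
    `|p x| ^+ 2 * H + `|p y| ^+ 2 * H' by rewrite !real_normK ?num_real// /H /H'; ring.
  (* A square weighted by [H'] avoids the square roots of [H] and [H']; with [H H' = 1] it expands
     to the required difference. *)
  have : 0 <= H' * (`|p x| * H - `|p y|) ^+ 2 by rewrite mulr_ge0 ?sqr_ge0.
  suff -> : H' * (`|p x| * H - `|p y|) ^+ 2 =
    `|p x| ^+ 2 * H * (H * H') - 2 * (`|p x| * `|p y|) * (H * H') + `|p y| ^+ 2 * H'.
    by rewrite HH'; lra.
  by ring.
have mf1 := measurable_tonelli mf f0.
apply: (@le_trans _ _ (\int[mu]_x (\int[mu]_y (f x y)%:E + \int[mu]_y (f y x)%:E))%E).
  apply: ge0_le_integral => //.
  - by move=> x _; apply: integral_ge0 => y _; rewrite lee_fin !mulr_ge0.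
  - apply: (@measurable_tonelli _ (fun x y => K x y * (`|p x| * `|p y|))); first by measurability.
    by move=> x y; rewrite !mulr_ge0.
  - by apply: emeasurable_funD => //; apply: (@measurable_tonelli _ (fun x y => f y x)).
  move=> x _; rewrite -ge0_integralD//.
  - apply: ge0_le_integral => //.
    + by move=> y _; rewrite lee_fin !mulr_ge0.
    + by apply/measurable_EFinP; have mKx := measurable_fun1 x mK; measurability.
    + apply/measurable_EFinP; apply: measurable_funD; first exact: measurable_fun1.
      exact: measurable_fun2 mf.
    + by move=> y _; rewrite lee_fin.
  - by move=> y _; rewrite lee_fin.
  - by apply/measurable_EFinP; exact: measurable_fun1.
  - by move=> y _; rewrite lee_fin.
  - by apply/measurable_EFinP; exact: (measurable_fun2 x mf).
rewrite ge0_integralD//; last 3 first.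
  - by move=> x _; apply: integral_ge0 => y _; rewrite lee_fin.
  - by move=> x _; apply: integral_ge0 => y _; rewrite lee_fin.
  - by apply: (@measurable_tonelli _ (fun x y => f y x)).
rewrite -[X in (_ + X <= _)%E](@tonelli _ f)//.
rewrite -ge0_integralD//; last 2 first.
  - by move=> x _; apply: integral_ge0 => y _; rewrite lee_fin.
  - by move=> x _; apply: integral_ge0 => y _; rewrite lee_fin.
rewrite le_eqVlt; apply/orP; left; apply/eqP; apply: eq_integral => x _.
rewrite -ge0_integralD//; last 4 first.
  - by move=> y _; rewrite lee_fin.
  - by apply/measurable_EFinP; exact: measurable_fun1.
  - by move=> y _; rewrite lee_fin.
  - by apply/measurable_EFinP; exact: measurable_fun1.
by apply: eq_integral => y _; rewrite -EFinD /f; congr EFin; lra.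
Qed.

Lemma gauss_convolution u v x : 0 < u -> 0 <= v ->
  (\int[mu]_y (Num.sqrt (pi / u) * (expR (- ((x - y) ^+ 2 / (4 * u))) * expR (- (v * y ^+ 2))))%:E =
   (2 * pi * ((1 + 4 * u * v) `^ (- 2^-1) *
      expR (- (v * x ^+ 2 * (1 + 4 * u * v) `^ (-1)))))%:E)%E.
Proof.
move=> u0 v0; set T := 1 + 4 * u * v.
have T0 : 0 < T by rewrite /T ltr_pwDl// !mulr_ge0// ltW.
have Tn0 := lt0r_neq0 T0; have un0 := lt0r_neq0 u0.
have A0 : 0 < T / (4 * u) by rewrite divr_gt0// mulr_gt0.
(* Completing the square in [y] centres the Gaussian at [x / T] with rate [T / (4 u)]. *)
transitivity (\int[mu]_y (Num.sqrt (pi / u) * expR (- (v * x ^+ 2 * T^-1)) *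
   expR (- (T / (4 * u) * (y - x / T) ^+ 2)))%:E)%E.
  apply: eq_integral => y _; rewrite -mulrA -!expRD; congr (_ * expR _)%:E.
  by rewrite /T; field; rewrite un0 andbT.
rewrite ge0_integral_mull ?mulr_ge0 ?sqrtr_ge0 ?expR_ge0//; last first.
  exact: measurable_gauss.
rewrite integral_gauss// -EFinM powR_inv1 ?ltW//; congr EFin.
rewrite powRN powR12_sqrt ?ltW//.
rewrite mulrAC -sqrtrM; last by rewrite divr_ge0 ?pi_ge0 ?ltW.
have -> : pi / u * (pi / (T / (4 * u))) = (2 * pi) ^+ 2 / T.
  by field; rewrite Tn0 un0.
rewrite sqrtrM ?sqr_ge0// sqrtrV ?ltW// sqrtr_sqr ger0_norm; last first.
  by rewrite mulr_ge0// pi_ge0.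
by rewrite mulrA.
Qed.

(* Up to the factor [2 * pi], the convolution of the two Gaussians of
   gauss_convolution. *)
Definition gauss_factor u v x := (1 + 4 * u * v) `^ (- 2^-1) * expR (- (v * x ^+ 2 * (1 + 4 * u * v) `^ (-1))).

Lemma gauss_factor_ge0 u v x : 0 <= gauss_factor u v x.
Proof. by rewrite mulr_ge0 ?powR_ge0 ?expR_ge0. Qed.

Lemma weight_ge0 p (b x : R) : 0 <= p x ^+ 2 * `|x| `^ b.
Proof. by rewrite mulr_ge0 ?sqr_ge0 ?powR_ge0. Qed.

(** The Schur test with [h x = |x|^{2 c}] leaves the Gaussian kernel integrated against
    [|y|^{- 2 c}]. [Gamma(c)] times this weight is a mixture of the Gaussians [e^{- v y^2}], so the
    [y]-integral becomes a convolution of Gaussians. *)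
Lemma pitt_gauss p c u : mu.-integrable setT (EFin \o p) -> p 0 = 0 -> 0 < u ->
  0 < c <= 1 ->
  ((Gamma c)%:E * \int[mu]_w (expR (- (u * w ^+ 2)) * spectrum p w)%:E <=
   \int[mu]_x \int[mu]_v (2 * pi * (p x ^+ 2 * `|x| `^ (2 * c) *
      (gamma_weight c v * gauss_factor u v x)))%:E)%E.
Proof.
move=> ip p0 u0 c01; have mp := measurable_integrable ip.
have Gc := Gamma_gt0 c01; have c0 : 0 < c by case/andP: c01.
have Gc0 : (0 <= (Gamma c)%:E)%E by rewrite lee_fin ltW.
pose S x y := Num.sqrt (pi / u) * expR (- ((x - y) ^+ 2 / (4 * u))) : R.
have S0 x y : 0 <= S x y by rewrite mulr_ge0 ?sqrtr_ge0 ?expR_ge0.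
have mS : measurable_fun setT (fun z : R * R => S z.1 z.2) by rewrite /S; measurability.
have Ssym x y : S x y = S y x by rewrite /S -sqrrN opprB.
pose h x := `|x| `^ (2 * c); pose h' x := `|x| `^ (- (2 * c)).
have mh : measurable_fun setT h by rewrite /h; measurability.
have mh' : measurable_fun setT h' by rewrite /h'; measurability.
have h0 x : 0 <= h x by exact: powR_ge0.
have h'0 x : 0 <= h' x by exact: powR_ge0.
(* Both powers take the value 0 at the origin, so the two weights are inverse only away from it;
   [p 0 = 0] excludes that point. *)
have hh' x : p x != 0 -> h x * h' x = 1.
  have [->|x0 _] := eqVneq x 0; first by rewrite p0 eqxx.
  by rewrite /h /h' powRN divff// gt_eqF// powR_gt0// normr_gt0.
have st := schur_test mS S0 Ssym mp mh mh' h0 h'0 hh'.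
apply: (@le_trans _ _ ((Gamma c)%:E * \int[mu]_x \int[mu]_y (S x y * (p x ^+ 2 * h x * h' y))%:E)%E).
  rewrite lee_wpmul2l//; apply: le_trans st; apply: (le_trans (spectrum_gauss ip u0)).
  rewrite le_eqVlt; apply/orP; left; apply/eqP.
  by apply: eq_integral => x _; apply: eq_integral => y _; congr EFin; rewrite /S; ring.
have T0 x y : 0 <= S x y * (p x ^+ 2 * h x * h' y).
  by rewrite mulr_ge0// mulr_ge0// weight_ge0.
have mT : measurable_fun setT (fun z : R * R => S z.1 z.2 * (p z.1 ^+ 2 * h z.1 * h' z.2)).
  by measurability.
have mTI := @measurable_tonelli _ (fun x y => S x y * (p x ^+ 2 * h x * h' y)) mT T0.
have TI0 x : setT x -> (0 <= \int[mu]_y (S x y * (p x ^+ 2 * h x * h' y))%:E)%E.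
  by move=> _; apply: integral_ge0 => y _; rewrite lee_fin.
rewrite -ge0_integralZl; [|exact: measurableT|exact: mTI|exact: TI0|exact: Gc0].
have U0 x v : 0 <= 2 * pi * (p x ^+ 2 * `|x| `^ (2 * c) * (gamma_weight c v * gauss_factor u v x)).
  apply: mulr_ge0; first by rewrite mulr_ge0// pi_ge0.
  by apply: mulr_ge0; [exact: weight_ge0 | rewrite mulr_ge0 ?gamma_weight_ge0 ?gauss_factor_ge0].
have mU : measurable_fun setT (fun z : R * R => 2 * pi * (p z.1 ^+ 2 * `|z.1| `^ (2 * c) * (gamma_weight c z.2 * gauss_factor u z.2 z.1))).
  by rewrite /gauss_factor; measurability.
apply: ge0_le_integral => //.
- by move=> x _; rewrite mule_ge0//; apply: integral_ge0 => y _; rewrite lee_fin.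
- exact: measurable_funeM.
- exact: (@measurable_tonelli _ (fun x v => 2 * pi * (p x ^+ 2 * `|x| `^ (2 * c) * (gamma_weight c v * gauss_factor u v x)))).
move=> x _.
have mSx : measurable_fun setT (S x) by exact: measurable_fun1.
pose V y v := S x y * (p x ^+ 2 * h x) * (gamma_weight c v * expR (- (y ^+ 2 * v))).
have SW y : 0 <= S x y * (p x ^+ 2 * h x) by apply: mulr_ge0 => //; exact: weight_ge0.
have V0 y v : 0 <= V y v.
  by rewrite /V; apply: mulr_ge0 => //; rewrite mulr_ge0 ?gamma_weight_ge0 ?expR_ge0.
have mV : measurable_fun setT (fun z : R * R => V z.1 z.2) by rewrite /V; measurability.
apply: (@le_trans _ _ (\int[mu]_y \int[mu]_v (V y v)%:E)%E).
  have mTx : measurable_fun setT (fun y => S x y * (p x ^+ 2 * h x * h' y)).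
    by measurability.
  rewrite -(ge0_integral_mull (ltW Gc) mTx (T0 x)).
  apply: ge0_le_integral => //.
  - by move=> y _; rewrite lee_fin mulr_ge0 ?(ltW Gc).
  - by apply/measurable_EFinP; measurability.
  - exact: measurable_tonelli.
  move=> y _; rewrite /V ge0_integral_mull; last 3 first.
    exact: SW.
    by measurability.
    by move=> v; rewrite mulr_ge0 ?gamma_weight_ge0 ?expR_ge0.
  (* At [y = 0] the power [h' y] is 0 by convention while the mixture in [v] is not; the inequality
     still holds there. *)
  have [->|y0] := eqVneq y 0.
    rewrite {1}/h' normr0 powR0 ?mulr0; last by rewrite oppr_eq0 mulf_neq0// gt_eqF.
    rewrite mule_ge0 ?lee_fin//.
    by apply: integral_ge0 => v _; rewrite lee_fin mulr_ge0 ?gamma_weight_ge0 ?expR_ge0.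
  have y20 : 0 < y ^+ 2 by rewrite exprn_even_gt0.
  rewrite integral_gamma_weight// -EFinM lee_fin.
  have -> : (y ^+ 2) `^ (- c) = h' y.
    by rewrite /h' -(real_normK (num_real y)) -powR_mulrn// -powRrM mulrN.
  rewrite le_eqVlt; apply/orP; left; apply/eqP; ring.
rewrite tonelli// le_eqVlt; apply/orP; left; apply/eqP; apply: eq_integral => v _.
have [v0|v0] := ltP 0 v; last first.
  rewrite /V /gamma_weight ltNge v0/= !(mul0r, mulr0).
  by under eq_integral do rewrite !(mul0r, mulr0); rewrite integral0.
transitivity (\int[mu]_y (p x ^+ 2 * h x * gamma_weight c v * (Num.sqrt (pi / u) * (expR (- ((x - y) ^+ 2 / (4 * u))) * expR (- (v * y ^+ 2)))))%:E)%E.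
  by apply: eq_integral => y _; congr EFin; rewrite /V /S [v * _]mulrC; ring.
rewrite ge0_integral_mull; last 3 first.
- by apply: mulr_ge0; [exact: weight_ge0 | exact: gamma_weight_ge0].
- by measurability.
- by move=> y; rewrite !mulr_ge0 ?expR_ge0 ?sqrtr_ge0.
rewrite gauss_convolution ?(ltW v0)// -EFinM; congr EFin; rewrite /h /gauss_factor; ring.
Qed.

End SchurTest.

(** * Pitt's inequality for real functions *)

Section PittPunctured.
Context {R : realType}.
Notation mu := (@lebesgue_measure R).
Implicit Types (p h : R -> R) (u v w x y a c : R).

Let measurable_triple p a c : measurable_fun setT p ->
  measurable_fun setT (fun z : R * R * R => gamma_weight a z.1.1 *
    (2 * pi * (p z.1.2 ^+ 2 * `|z.1.2| `^ (2 * c) *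
      (gamma_weight c z.2 * gauss_factor z.1.1 z.2 z.1.2)))).
Proof.
move=> mp.
have m1 : measurable_fun setT (fun z : R * R * R => z.1.1).
  by apply: (measurableT_comp measurable_fst measurable_fst).
have m2 : measurable_fun setT (fun z : R * R * R => z.1.2).
  by apply: (measurableT_comp measurable_snd measurable_fst).
have mp2 : measurable_fun setT (fun z : R * R * R => p z.1.2) by apply: measurableT_comp m2.
by rewrite /gauss_factor; measurability.
Qed.

(** Integrate [pitt_gauss] in [u] against [u^{a - 1}]: on the left the Gaussians add up to
    [Gamma(a) |w|^{- 2 a}]. On the right [x] moves outermost, so that the [u]- and [v]-integrals can
    be computed at fixed [x]. *)
Lemma pitt_subordinated p a c : mu.-integrable setT (EFin \o p) -> p 0 = 0 ->
  0 < a <= 1 -> 0 < c <= 1 -> 0 < c - a ->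
  ((Gamma c)%:E * ((Gamma a)%:E *
     \int[mu]_w (`|w| `^ (- (2 * a)) * spectrum p w)%:E) <=
   \int[mu]_x \int[mu]_u \int[mu]_v (gamma_weight a u * (2 * pi * (p x ^+ 2 * `|x| `^ (2 * c) *
      (gamma_weight c v * gauss_factor u v x))))%:E)%E.
Proof.
move=> ip p0 a01 c01 ca0; have mp := measurable_integrable ip.
have Gc := ltW (Gamma_gt0 c01); have Ga := ltW (Gamma_gt0 a01).
have a0 : 0 < a by case/andP: a01.
have ms := measurable_spectrum mp; have s0 := spectrum_ge0 p.
have V0 u x v : 0 <= 2 * pi * (p x ^+ 2 * `|x| `^ (2 * c) * (gamma_weight c v * gauss_factor u v x)).
  apply: mulr_ge0; first by rewrite mulr_ge0// pi_ge0.
  by apply: mulr_ge0; [exact: weight_ge0 | rewrite mulr_ge0 ?gamma_weight_ge0 ?gauss_factor_ge0].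
pose F (z : R * R) := (\int[mu]_v (gamma_weight a z.1 * (2 * pi * (p z.2 ^+ 2 * `|z.2| `^ (2 * c) *
      (gamma_weight c v * gauss_factor z.1 v z.2))))%:E)%E.
have F0 z : (0 <= F z)%E.
  by apply: integral_ge0 => v _; rewrite lee_fin mulr_ge0 ?gamma_weight_ge0.
have mF : measurable_fun setT F.
  apply: (@measurable_fun_fubini_tonelli_F _ _ _ _ _ mu (fun z : R * R * R => (gamma_weight a z.1.1 *
    (2 * pi * (p z.1.2 ^+ 2 * `|z.1.2| `^ (2 * c) *
      (gamma_weight c z.2 * gauss_factor z.1.1 z.2 z.1.2))))%:E)).
    by apply/measurable_EFinP; exact: measurable_triple.
  by move=> z; rewrite lee_fin mulr_ge0 ?gamma_weight_ge0.
have <- := @fubini_tonelli _ _ _ _ _ mu mu F mF F0.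
pose g w u := gamma_weight a u * (expR (- (u * w ^+ 2)) * spectrum p w).
have g0 w u : 0 <= g w u.
  by rewrite /g; apply: mulr_ge0; [exact: gamma_weight_ge0|apply: mulr_ge0 => //; exact: expR_ge0].
have mg : measurable_fun setT (fun z : R * R => g z.1 z.2) by rewrite /g; measurability.
have ga0 w : 0 <= `|w| `^ (- (2 * a)) * spectrum p w by rewrite mulr_ge0 ?powR_ge0.
apply: (@le_trans _ _ ((Gamma c)%:E * \int[mu]_u \int[mu]_w (g w u)%:E)%E).
  rewrite lee_wpmul2l// -(tonelli mg g0).
  rewrite -ge0_integral_mull//; last by measurability.
  apply: ge0_le_integral => //.
  - by move=> w _; rewrite lee_fin mulr_ge0.
  - by apply/measurable_EFinP; measurability.
  - exact: measurable_tonelli.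
  move=> w _; rewrite /g.
  rewrite [leRHS](_ : _ = (\int[mu]_u (spectrum p w * (gamma_weight a u * expR (- (w ^+ 2 * u))))%:E)%E); last first.
    by apply: eq_integral => u _; congr EFin; rewrite [u * _]mulrC; ring.
  have h0 u : 0 <= gamma_weight a u * expR (- (w ^+ 2 * u)).
    by rewrite mulr_ge0 ?gamma_weight_ge0 ?expR_ge0.
  rewrite ge0_integral_mull//; last by measurability.
  have [->|w0] := eqVneq w 0.
    rewrite normr0 powR0 ?mul0r ?mulr0; last by rewrite oppr_eq0 mulf_neq0// gt_eqF.
    rewrite mule_ge0 ?lee_fin//; apply: integral_ge0 => u _.
    by rewrite lee_fin mulr_ge0 ?gamma_weight_ge0 ?expR_ge0.
  have w20 : 0 < w ^+ 2 by rewrite exprn_even_gt0.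
  rewrite integral_gamma_weight// -EFinM lee_fin.
  have -> : (w ^+ 2) `^ (- a) = `|w| `^ (- (2 * a)).
    by rewrite -(real_normK (num_real w)) -powR_mulrn// -powRrM mulrN.
  by rewrite le_eqVlt; apply/orP; left; apply/eqP; ring.
rewrite -ge0_integralZl//; last 2 first.
  exact: (@measurable_tonelli _ (fun u w => g w u) (measurable_swapped mg)).
  by move=> u _; apply: integral_ge0 => w _; rewrite lee_fin.
apply: ge0_le_integral => //.
- by move=> u _; rewrite mule_ge0//; apply: integral_ge0 => w _; rewrite lee_fin.
- apply: measurable_funeM.
  exact: (@measurable_tonelli _ (fun u w => g w u) (measurable_swapped mg)).
- exact: (@measurable_fun_fubini_tonelli_F _ _ _ _ _ mu F mF F0).
move=> u _.
(* [pitt_gauss] applies for [u > 0] only; elsewhere the weight in [u] makes the left side 0. *)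
have [u0|u0] := ltP 0 u; last first.
  rewrite /g /gamma_weight [0 < u]ltNge u0/=.
  under eq_integral do rewrite mul0r.
  by rewrite integral0 mule0; apply: integral_ge0 => x _; exact: F0.
rewrite /g ge0_integral_mull ?gamma_weight_ge0//; last 2 first.
  by measurability.
  by move=> w; apply: mulr_ge0 => //; exact: expR_ge0.
rewrite muleCA.
have mV : measurable_fun setT (fun z : R * R => 2 * pi * (p z.1 ^+ 2 * `|z.1| `^ (2 * c) * (gamma_weight c z.2 * gauss_factor u z.2 z.1))).
  by rewrite /gauss_factor; measurability.
apply: (le_trans (lee_wpmul2l _ (pitt_gauss ip p0 u0 c01))).
  by rewrite lee_fin gamma_weight_ge0.
rewrite -ge0_integralZl//; last 3 first.
  exact: (@measurable_tonelli _ (fun x v => 2 * pi * (p x ^+ 2 * `|x| `^ (2 * c) * (gamma_weight c v * gauss_factor u v x)))).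
  by move=> x _; apply: integral_ge0 => v _; rewrite lee_fin.
  by rewrite lee_fin gamma_weight_ge0.
rewrite le_eqVlt; apply/orP; left; apply/eqP; apply: eq_integral => x _.
rewrite /F/= [RHS]ge0_integral_mull ?gamma_weight_ge0//.
exact: (@measurable_fun1 _ (fun x v => 2 * pi * (p x ^+ 2 * `|x| `^ (2 * c) * (gamma_weight c v * gauss_factor u v x))) x mV).
Qed.

(** The relation [2 c = a + 1 / 2] turns the exponent [c - a - 1 / 2] of [riesz_integral] into
    [- c], so the remaining integral is the Beta integral. The powers of [|x|] combine as
    [2 c - 2 (c - a) = 2 a]. *)
Let riesz_at p a c x : x != 0 ->
  0 < a <= 1 -> 0 < c <= 1 -> 0 < c - a -> 2 * c = a + 2^-1 ->
  (\int[mu]_u \int[mu]_v (gamma_weight a u * (2 * pi *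
      (p x ^+ 2 * `|x| `^ (2 * c) * (gamma_weight c v * gauss_factor u v x))))%:E =
  ((Gamma c)^-1 * (2 * pi * 4 `^ (- a) * (Gamma (c - a) * Gamma (c - a)) * Gamma a) *
    (`|x| `^ (2 * a) * p x ^+ 2))%:E)%E.
Proof.
move=> x0 a01 c01 ca0 c2a.
have Gc := Gamma_gt0 c01.
have ca01 : 0 < c - a <= 1 by rewrite ca0; case/andP: a01; lra.
have x20 : 0 < x ^+ 2 by rewrite exprn_even_gt0.
pose K := 2 * pi * (p x ^+ 2 * `|x| `^ (2 * c)) : R.
have K0 : 0 <= K by rewrite mulr_ge0 ?weight_ge0// mulr_ge0// pi_ge0.
pose f u v := gamma_weight a u * (gamma_weight c v * gauss_factor u v x).
have f0 u v : 0 <= f u v.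
  apply: mulr_ge0; first exact: gamma_weight_ge0.
  by apply: mulr_ge0; [exact: gamma_weight_ge0|exact: gauss_factor_ge0].
have mf : measurable_fun setT (fun z : R * R => f z.1 z.2).
  by rewrite /f /gauss_factor; measurability.
transitivity (K%:E * \int[mu]_u \int[mu]_v (f u v)%:E)%E.
  rewrite -ge0_integralZl//; last 2 first.
    exact: measurable_tonelli.
    by move=> u _; apply: integral_ge0 => v _; rewrite lee_fin.
  apply: eq_integral => u _; rewrite -(ge0_integral_mull K0 (measurable_fun1 u mf) (f0 u)).
  by apply: eq_integral => v _; congr EFin; rewrite /f /K; ring.
rewrite /f /gauss_factor riesz_integral//.
have -> : c - a - 2^-1 = - c by lra.
set beta := (\int[mu]_k _)%E.
have -> : beta = ((Gamma c)^-1 * (Gamma a * Gamma (c - a)))%:E.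
  by rewrite EFinM -beta_integral// muleA -EFinM mulVf ?mul1e// gt_eqF.
rewrite -!EFinM; congr EFin.
have -> : `|x| `^ (2 * a) = `|x| `^ (2 * c) * (x ^+ 2) `^ (- (c - a)).
  rewrite -(real_normK (num_real x)) -powR_mulrn// -powRrM -powRD; last first.
    by rewrite normr_eq0 x0 implybT.
  by congr (_ `^ _); lra.
by rewrite /K; ring.
Qed.

(** The left side of [pitt_subordinated] carries [Gamma(c) Gamma(a)], and [riesz_at] gives the right
    side up to a further [Gamma(c)]. After clearing it, the positive factor [Gamma(c)^2 Gamma(a)] is
    cancelled. *)
Lemma pitt_punctured p a c : mu.-integrable setT (EFin \o p) -> p 0 = 0 ->
  0 < a <= 1 -> 0 < c <= 1 -> 0 < c - a -> 2 * c = a + 2^-1 ->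
  (\int[mu]_w (`|w| `^ (- (2 * a)) * spectrum p w)%:E <=
   (2 * pi * 4 `^ (- a) * (Gamma (c - a) / Gamma c) ^+ 2)%:E *
     \int[mu]_x (`|x| `^ (2 * a) * p x ^+ 2)%:E)%E.
Proof.
move=> ip p0 a01 c01 ca0 c2a; have mp := measurable_integrable ip.
have ca01 : 0 < c - a <= 1 by rewrite ca0; case/andP: a01; lra.
have W0 x : 0 <= `|x| `^ (2 * a) * p x ^+ 2 by rewrite mulrC weight_ge0.
have A0 : 0 <= 4 `^ (- a) :> R by exact: powR_ge0.
have pi0 : 0 <= pi :> R by exact: pi_ge0.
have sub := pitt_subordinated ip p0 a01 c01 ca0.
have off0 x (x0 : x != 0) := riesz_at p x0 a01 c01 ca0 c2a.
move: sub off0 (Gamma_gt0 c01) (Gamma_gt0 a01) (Gamma_gt0 ca01).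
generalize (Gamma c) (Gamma a) (Gamma (c - a)) => G G1 G2 sub off0 Gp G1p G2p.
have Gn0 := lt0r_neq0 Gp; have G1n0 := lt0r_neq0 G1p.
pose C := 2 * pi * 4 `^ (- a) * (G2 * G2) * G1 : R.
have C0 : 0 <= C.
  rewrite /C; apply: mulr_ge0; last exact: ltW.
  apply: mulr_ge0; last by rewrite mulr_ge0 ?(ltW G2p).
  by apply: mulr_ge0 => //; exact: mulr_ge0.
have h : (G%:E * \int[mu]_x \int[mu]_u \int[mu]_v (gamma_weight a u * (2 * pi *
      (p x ^+ 2 * `|x| `^ (2 * c) * (gamma_weight c v * gauss_factor u v x))))%:E =
    C%:E * \int[mu]_x (`|x| `^ (2 * a) * p x ^+ 2)%:E)%E.
  rewrite (_ : (fun x => \int[mu]_u \int[mu]_v _)%E = (fun x => (G^-1 * C * (`|x| `^ (2 * a) * p x ^+ 2))%:E)); last first.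
    apply/funext => x.
    (* The computation in [riesz_at] leaves out the origin, where [p 0 = 0] makes both sides
       zero. *)
    have [x0|x0] := eqVneq x 0.
      rewrite x0 p0 expr0n/= mul0r !mulr0.
      rewrite (_ : (fun u => \int[mu]_v _)%E = cst 0%E) ?integral0//; apply/funext => u.
      by under eq_integral do rewrite mul0r !mulr0; rewrite integral0.
    exact: off0.
  rewrite ge0_integral_mull; [|by apply: mulr_ge0 => //; rewrite invr_ge0 ltW|by measurability|exact: W0].
  by rewrite muleA -EFinM mulrA divff// mul1r.
have G0 : (0 <= G%:E)%E by rewrite lee_fin ltW.
have := lee_wpmul2l G0 sub; rewrite h muleA -EFinM muleA -EFinM => h1.
have GG0 : 0 < G * G * G1 by rewrite mulr_gt0// mulr_gt0.
rewrite -(@lee_pmul2l _ (G * G * G1)%:E)// muleA -EFinM.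
rewrite (_ : G * G * G1 * (2 * pi * 4 `^ (- a) * (G2 / G) ^+ 2) = C)//.
rewrite /C; move: (4 `^ (- a)) (pi : R) => A P; field; exact: Gn0.
Qed.

(** Regularize by [e^{- u w^2}] with [u = 1 / (n + 1)] and let [n] grow, by monotone convergence.
    For each [u] the Schur test with weight 1 suffices, the kernel having total mass [2 pi] in [y]
    whatever [u] is. *)
Lemma plancherel p : mu.-integrable setT (EFin \o p) ->
  (\int[mu]_w (spectrum p w)%:E <= (2 * pi)%:E * \int[mu]_x (p x ^+ 2)%:E)%E.
Proof.
move=> ip; have mp := measurable_integrable ip.
have ms := measurable_spectrum mp; have s0 := spectrum_ge0 p.
pose g n w := (expR (- (n.+1%:R^-1 * w ^+ 2)) * spectrum p w)%:E.
have mg n : measurable_fun setT (g n) by apply/measurable_EFinP; measurability.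
have g0 n w : setT w -> (0 <= g n w)%E.
  by move=> _; rewrite lee_fin; apply: mulr_ge0 => //; exact: expR_ge0.
have gnd w : setT w -> {homo g^~ w : n m / (n <= m)%N >-> (n <= m)%E}.
  move=> _ n m nm; rewrite lee_fin ler_wpM2r// ler_expR lerN2 ler_wpM2r ?sqr_ge0//.
  by rewrite lef_pV2 ?posrE// ler_nat ltnS.
have glim w : g ^~ w @ \oo --> (spectrum p w)%:E.
  apply: cvg_EFin; first exact: nearW.
  rewrite -[X in _ --> X]mul1r; apply: cvgMr_tmp.
  rewrite -[X in _ --> X]expR0; apply: continuous_cvg; first exact: continuous_expR.
  rewrite -[X in _ --> X]oppr0; apply: cvgN; rewrite -[X in _ --> X](mul0r (w ^+ 2)).
  by apply: cvgMr_tmp; exact: cvg_harmonic.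
have -> : (\int[mu]_w (spectrum p w)%:E = limn (fun n => \int[mu]_w (g n w)))%E.
  rewrite -monotone_convergence//; apply: eq_integral => w _.
  by apply/esym/cvg_lim => //; exact: glim.
apply: lime_le.
  apply: ereal_nondecreasing_is_cvgn => n m nm; apply: ge0_le_integral => //.
  - by move=> w; exact: g0.
  - exact: mg.
  - exact: mg.
  - by move=> w wT; exact: gnd.
apply: nearW => n.
have u0 : 0 < n.+1%:R^-1 :> R by rewrite invr_gt0.
set u := n.+1%:R^-1 in u0.
apply: (le_trans (spectrum_gauss ip u0)).
pose S x y := Num.sqrt (pi / u) * expR (- ((x - y) ^+ 2 / (4 * u))) : R.
have S0 x y : 0 <= S x y by rewrite mulr_ge0 ?sqrtr_ge0 ?expR_ge0.
have mS : measurable_fun setT (fun z : R * R => S z.1 z.2) by rewrite /S; measurability.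
have Ssym x y : S x y = S y x by rewrite /S -sqrrN opprB.
have st := @schur_test _ S p (cst 1) (cst 1) mS S0 Ssym mp (measurable_cst _) (measurable_cst _)
  (fun=> ler01) (fun=> ler01) (fun _ _ => mulr1 _).
apply: (@le_trans _ _ (\int[mu]_x \int[mu]_y (S x y * (`|p x| * `|p y|))%:E)%E).
  rewrite le_eqVlt; apply/orP; left; apply/eqP.
  by apply: eq_integral => x _; apply: eq_integral => y _; congr EFin; rewrite /S; ring.
apply: (le_trans st).
rewrite -ge0_integral_mull; last 3 first.
- by rewrite mulr_ge0// pi_ge0.
- by measurability.
- by move=> x; exact: sqr_ge0.
rewrite le_eqVlt; apply/orP; left; apply/eqP; apply: eq_integral => x _.
(* The mass of the kernel is the case [v = 0] of [gauss_convolution]. *)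
transitivity (\int[mu]_y (p x ^+ 2 * (Num.sqrt (pi / u) * (expR (- ((x - y) ^+ 2 / (4 * u))) * expR (- (0 * y ^+ 2)))))%:E)%E.
  by apply: eq_integral => y _; congr EFin; rewrite /S /= mul0r oppr0 expR0; ring.
rewrite ge0_integral_mull; last 3 first.
- exact: sqr_ge0.
- by measurability.
- by move=> y; rewrite !mulr_ge0 ?expR_ge0 ?sqrtr_ge0.
rewrite gauss_convolution// mulr0 addr0 powR1 !mul0r oppr0 expR0 !mulr1 -EFinM.
by rewrite mulrC.
Qed.

End PittPunctured.

(** * Pitt's inequality without the condition at the origin, including the exponent 0 *)

Section PittGeneral.
Context {R : realType}.
Notation mu := (@lebesgue_measure R).
Implicit Types (p f g : R -> R).

Lemma ae_eq_off0 f g : (forall x, x != 0 -> f x = g x) ->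
  ae_eq mu setT (EFin \o f) (EFin \o g).
Proof.
move=> fg; exists [set 0]; split => //; first exact: lebesgue_measure_set1.
move=> x /=; apply: contra_notP => /eqP x0 _; congr EFin; exact: fg.
Qed.

Lemma Rintegral_off0 f g : (forall x, x != 0 -> f x = g x) ->
  measurable_fun setT f -> measurable_fun setT g ->
  \int[mu]_x f x = \int[mu]_x g x.
Proof.
move=> fg mf mg; congr fine; apply: ae_eq_integral => //.
- exact/measurable_EFinP.
- exact/measurable_EFinP.
- exact: ae_eq_off0.
Qed.

Lemma pitt_real p lambda : 0 <= lambda -> lambda < 1 -> mu.-integrable setT (EFin \o p) ->
  (\int[mu]_w (`|w| `^ (- lambda) * spectrum p w)%:E <=
   (2 * pi * pitt_const lambda)%:E * \int[mu]_x (`|x| `^ lambda * p x ^+ 2)%:E)%E.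
Proof.
rewrite le_eqVlt => /predU1P[<- _|l0 l1] ip; have mp := measurable_integrable ip.
  (* At exponent 0 the two Gamma values coincide, so [pitt_const] is 1 and the claim is
     [plancherel]. *)
  have G0 : Gamma (1 / 4) != 0 :> R by rewrite gt_eqF// Gamma_gt0//; lra.
  rewrite /pitt_const powRr0 subr0 addr0 divff// expr1n !mulr1.
  under eq_integral do rewrite oppr0 powRr0 mul1r.
  under [in leRHS]eq_integral do rewrite powRr0 mul1r.
  exact: plancherel.
pose a := lambda / 2; pose c := (1 + lambda) / 4.
have ca : c - a = (1 - lambda) / 4 by rewrite /c /a; lra.
have a2 : 2 * a = lambda by rewrite /a; lra.
have a01 : 0 < a <= 1 by rewrite /a; apply/andP; split; lra.
have c01 : 0 < c <= 1 by rewrite /c; apply/andP; split; lra.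
have ca0 : 0 < c - a by rewrite ca; lra.
have c2a : 2 * c = a + 2^-1 by rewrite /a /c; lra.
(* pitt_punctured uses the weight [|x| `^ (- (2 * c))], whose value at 0 is 0 and
   not +oo; hence the modification of p at the origin. *)
pose q x := if x == 0 then 0 else p x.
have pq x : x != 0 -> q x = p x by rewrite /q => /negbTE ->.
have mq : measurable_fun setT q.
  rewrite /q; apply: measurable_fun_if => //; first exact: measurable_fun_eqr.
  by apply: measurable_funTS.
have iq : mu.-integrable setT (EFin \o q).
  apply: (le_integrable _ _ _ ip) => //; first exact/measurable_EFinP.
  by move=> x _ /=; rewrite lee_fin /q; case: ifP => // _; rewrite normr0.
have sq w : spectrum p w = spectrum q w.
  rewrite /spectrum /cos_transform /sin_transform.
  congr (_ ^+ 2 + _ ^+ 2); (apply: Rintegral_off0; [by move=> x x0; rewrite pq| by measurability | by measurability]).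
have q0 : q 0 = 0 by rewrite /q eqxx.
have := pitt_punctured iq q0 a01 c01 ca0 c2a; rewrite a2 ca.
under eq_integral do rewrite -sq.
move=> /le_trans; apply.
have pi1 : 1 <= pi :> R by apply: le_trans (pi_ge2 R); rewrite ler1n.
have k0 : 0 <= (Gamma ((1 - lambda) / 4) / Gamma ((1 + lambda) / 4)) ^+ 2 :> R by exact: sqr_ge0.
apply: (@lee_pmul _).
- rewrite lee_fin; apply: mulr_ge0 => //.
  by apply: mulr_ge0; [rewrite mulr_ge0// pi_ge0|exact: powR_ge0].
- by apply: integral_ge0 => x _; rewrite lee_fin mulrC weight_ge0.
- rewrite lee_fin /pitt_const -mulrA ler_wpM2l ?mulr_ge0 ?pi_ge0// ler_wpM2r//.
  (* The two constants are separated by 1: [4^{- a} <= 1 <= pi^lambda]. *)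
  apply: (@le_trans _ _ 1).
    rewrite powRN invf_le1 ?powR_gt0// -[leLHS](powRr0 4) ler_powR//; last by case/andP: a01 => /ltW.
    by rewrite ler1n.
  by rewrite -[leLHS](powRr0 pi) ler_powR// ltW.
apply: ge0_le_integral => //.
- by move=> x _; rewrite lee_fin mulrC weight_ge0.
- by apply/measurable_EFinP; measurability.
- by apply/measurable_EFinP; measurability.
- move=> x _; rewrite lee_fin ler_wpM2l ?powR_ge0// /q; case: ifP => // _.
  by rewrite expr0n/= sqr_ge0.
Qed.

End PittGeneral.

(** * The transform of a Schwartz function *)

Section ComplexValued.
Context {R : realType}.
Notation mu := (@lebesgue_measure R).
Implicit Types (f : R -> R[i]) (w z : R[i]).

Lemma sqr_cmod w : cmod w ^+ 2 = complex.Re w ^+ 2 + complex.Im w ^+ 2.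
Proof.
by case: w => x y; rewrite /cmod /Normc.normc/= sqr_sqrtr// addr_ge0 ?sqr_ge0.
Qed.

Lemma cmodM w z : cmod (w * z) = cmod w * cmod z.
Proof. exact: Normc.normcM. Qed.

Lemma cmod_ge0 w : 0 <= cmod w.
Proof. by case: w => x y; exact: sqrtr_ge0. Qed.

(** Removing the multiple of [pi] given by the floor of [alpha / pi] leaves [r] strictly between 0
    and [pi], where the sine is positive; shifts by [pi] only change its sign. *)
Lemma sin_neq0 (alpha : R) : (forall k : int, alpha != k%:~R * pi) -> sin alpha != 0.
Proof.
move=> halpha.
pose k := Num.floor (alpha / pi); pose r := alpha - k%:~R * pi.
have r0 : 0 < r.
  rewrite lt_neqAle eq_sym subr_eq0 halpha/= subr_ge0 -ler_pdivlMr ?pi_gt0//.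
  exact: floor_le.
have rpi : r < pi.
  rewrite ltrBlDr -[X in X + _]mul1r -mulrDl -ltr_pdivrMr ?pi_gt0//.
  by rewrite addrC -intrD1 floorD1_gt.
have sr : 0 < sin r by apply: sin_gt0_pi; rewrite r0.
have signM (n : nat) (x : R) : ((-1) ^+ n * x == 0) = (x == 0).
  by rewrite mulf_eq0 signr_eq0.
case E : k => [n|n].
  have -> : alpha = r + pi *+ n by rewrite /r E -mulr_natl subrK.
  by rewrite (alternatingn (@sinDpi R)) signM gt_eqF.
have -> : (sin alpha == 0) = (sin r == 0).
  (* The negative integers are [- (n + 1)], so here [r] is a shift of [alpha] upwards. *)
  have -> : r = alpha + pi *+ n.+1 by rewrite /r E NegzE mulrNz mulNr opprK -mulr_natl.
  by rewrite (alternatingn (@sinDpi R)) signM.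
by rewrite gt_eqF.
Qed.

(** The square of the root is [1 - i cot alpha], whose modulus is the square root of
    [1 + cot^2 = csc^2]. *)
Lemma cmod_cfactor (alpha : R) : sin alpha != 0 -> cmod (cfactor alpha) ^+ 2 = `|csc alpha|.
Proof.
move=> s0; rewrite expr2 -cmodM -expr2 sqr_sqrtc /cmod /= expr1n sqrrN.
have -> : 1 + cot alpha ^+ 2 = csc alpha ^+ 2.
  rewrite /cot /csc exprVn -[RHS]div1r -[X in _ = X / _](cos2Dsin2 alpha).
  by field.
exact: sqrtr_sqr.
Qed.

Lemma cmod_expi (x : R) : cmod (expi x) ^+ 2 = 1.
Proof. by rewrite sqr_cmod /= cos2Dsin2. Qed.

Lemma integrable_oneDsqrV : mu.-integrable setT (EFin \o (fun t : R => (1 + t ^+ 2)^-1)).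
Proof.
have mV : measurable_fun setT (fun t : R => (1 + t ^+ 2)^-1).
  by apply: continuous_measurable_fun; exact: (@continuous_oneDsqrV R).
have V0 (t : R) : 0 <= (1 + t ^+ 2)^-1 by rewrite invr_ge0 addr_ge0// sqr_ge0.
apply/integrableP; split; first exact/measurable_EFinP.
under eq_integral do rewrite /= ger0_norm//.
rewrite ge0_symfun_integralT//; last 2 first.
  exact: (@continuous_oneDsqrV R).
  by move=> t /=; rewrite sqrrN.
rewrite (_ : [set x : R | _] = `[0, +oo[%classic); last first.
  by apply/seteqP; split => x/=; rewrite in_itv/= andbT.
by have := @integral0y_oneDsqr R; rewrite /oneDsqr => ->; rewrite -EFinM ltry.
Qed.

Lemma schwartz_continuous f : schwartz f ->
  continuous (@complex.Re R \o f) /\ continuous (@complex.Im R \o f).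
Proof.
move=> [sm _]; split => t; apply: differentiable_continuous; apply/derivable1_diffP.
  by have [] := sm 0%N t.
by have [] := sm 0%N t.
Qed.

(** The decay bounds with powers 0 and 2 of [|t|] add up to a bound on [(1 + t^2) |f t|], which
    gives an integrable majorant. *)
Lemma schwartz_bound f : schwartz f ->
  exists M : R, forall t, cmod (f t) <= M * (1 + t ^+ 2)^-1.
Proof.
move=> [_ rd]; have [M0 h0] := rd 0%N 0%N; have [M2 h2] := rd 2%N 0%N.
exists (M0 + M2) => t.
have -> : f t = cderive1n 0 f t by rewrite /cderive1n/=; case: (f t).
rewrite ler_pdivlMr ?ltr_pwDl ?sqr_ge0// mulrDr mulr1 lerD//.
  by have := h0 t; rewrite expr0 mul1r.
by rewrite mulrC; have := h2 t; rewrite real_normK ?num_real.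
Qed.

End ComplexValued.

(** * Reduction of the transform to cosine and sine transforms of two real functions *)

Section Otransform.
Context {R : realType}.
Notation mu := (@lebesgue_measure R).
Implicit Types (f : R -> R[i]) (p q : R -> R) (w rho a : R).

Lemma ge0_integral_add p q : measurable_fun setT p -> measurable_fun setT q ->
  (forall x, 0 <= p x) -> (forall x, 0 <= q x) ->
  (\int[mu]_x (p x + q x)%:E = \int[mu]_x (p x)%:E + \int[mu]_x (q x)%:E)%E.
Proof.
move=> mp mq p0 q0; rewrite -ge0_integralD//.
- by move=> x _; rewrite lee_fin.
- exact/measurable_EFinP.
- by move=> x _; rewrite lee_fin.
- exact/measurable_EFinP.
Qed.

Definition chirp_re a f t := complex.Re (expi (a * t ^+ 2) * f t).
Definition chirp_im a f t := complex.Im (expi (a * t ^+ 2) * f t).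

Lemma chirp_sqr a f t : chirp_re a f t ^+ 2 + chirp_im a f t ^+ 2 = cmod (f t) ^+ 2.
Proof. by rewrite -sqr_cmod cmodM exprMn cmod_expi mul1r. Qed.

Lemma measurable_chirp a f : schwartz f ->
  measurable_fun setT (chirp_re a f) /\ measurable_fun setT (chirp_im a f).
Proof.
move=> /schwartz_continuous[cr ci].
have mr : measurable_fun setT (fun t => complex.Re (f t)) by exact: continuous_measurable_fun.
have mi : measurable_fun setT (fun t => complex.Im (f t)) by exact: continuous_measurable_fun.
split.
  rewrite (_ : chirp_re a f = fun t => cos (a * t ^+ 2) * complex.Re (f t) + - (sin (a * t ^+ 2) * complex.Im (f t))).
    by measurability.
  by apply/funext => t; rewrite /chirp_re; case: (f t).
rewrite (_ : chirp_im a f = fun t => cos (a * t ^+ 2) * complex.Im (f t) + sin (a * t ^+ 2) * complex.Re (f t)).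
  by measurability.
by apply/funext => t; rewrite /chirp_im; case: (f t).
Qed.

Lemma integrable_chirp a f : schwartz f ->
  mu.-integrable setT (EFin \o chirp_re a f) /\ mu.-integrable setT (EFin \o chirp_im a f).
Proof.
move=> sf; have [mr mi] := measurable_chirp a sf.
have [M hM] := schwartz_bound sf.
have bnd (x y c : R) : 0 <= c -> x ^+ 2 + y ^+ 2 = c ^+ 2 -> `|x| <= c.
  move=> c0 e; rewrite -(@ler_pXn2r _ 2) ?nnegrE// real_normK ?num_real// -e.
  by rewrite lerDl sqr_ge0.
split; apply: (le_integrable _ _ _ (integrable_mull M (integrable_oneDsqrV))) => //.
- exact/measurable_EFinP.
- move=> t _ /=; rewrite lee_fin; apply: le_trans (ler_norm _); apply: le_trans (hM t).
  by apply: bnd (cmod_ge0 _) (chirp_sqr a f t).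
- exact/measurable_EFinP.
- move=> t _ /=; rewrite lee_fin; apply: le_trans (ler_norm _); apply: le_trans (hM t).
  by apply: bnd (cmod_ge0 _) _; rewrite addrC; exact: (chirp_sqr a f t).
Qed.

(** This is [|G(w) + i rho G(- w)|^2] for the Fourier transform [G] of [p + i q], written out in
    real and imaginary parts. *)
Definition two_sided_spectrum rho p q w :=
  (cos_transform p w - rho * sin_transform p w - rho * cos_transform q w + sin_transform q w) ^+ 2 +
  (cos_transform q w - rho * sin_transform q w + rho * cos_transform p w - sin_transform p w) ^+ 2.

Lemma two_sided_spectrum_ge0 rho p q w : 0 <= two_sided_spectrum rho p q w.
Proof. by rewrite addr_ge0 ?sqr_ge0. Qed.

Lemma measurable_two_sided_spectrum rho p q : measurable_fun setT p -> measurable_fun setT q ->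
  measurable_fun setT (two_sided_spectrum rho p q).
Proof.
move=> mp mq; rewrite /two_sided_spectrum.
have mcp := measurable_cos_transform mp; have msp := measurable_sin_transform mp.
have mcq := measurable_cos_transform mq; have msq := measurable_sin_transform mq.
by measurability.
Qed.

Lemma cos_transformN p w : cos_transform p (- w) = cos_transform p w.
Proof. by apply: eq_Rintegral => t _; rewrite mulNr cosN. Qed.

Lemma sin_transformN p w : mu.-integrable setT (EFin \o p) ->
  sin_transform p (- w) = - sin_transform p w.
Proof.
move=> ip; rewrite /sin_transform -[RHS]mulN1r -RintegralZl//; last exact: integrable_mul_sin.
by apply: eq_Rintegral => t _; rewrite mulNr sinN; ring.
Qed.

(* The purely imaginary parameter makes the cross terms odd in the frequency. *)
Lemma two_sided_spectrumD rho p q w :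
  mu.-integrable setT (EFin \o p) -> mu.-integrable setT (EFin \o q) ->
  two_sided_spectrum rho p q w + two_sided_spectrum rho p q (- w) =
  2 * (1 + rho ^+ 2) * (spectrum p w + spectrum q w).
Proof.
move=> ip iq; rewrite /two_sided_spectrum /spectrum !cos_transformN !sin_transformN//.
by ring.
Qed.

(** The weight is even, so twice the left side is the integral of the sum over [w] and [- w]. In
    that sum the cross terms are gone, and [pitt_real] applies to [p] and [q] separately. *)
Lemma pitt_two_sided rho p q lambda : 0 <= lambda -> lambda < 1 ->
  mu.-integrable setT (EFin \o p) -> mu.-integrable setT (EFin \o q) ->
  (\int[mu]_w (`|w| `^ (- lambda) * two_sided_spectrum rho p q w)%:E <=
   (2 * pi * pitt_const lambda * (1 + rho ^+ 2))%:E *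
     \int[mu]_t (`|t| `^ lambda * (p t ^+ 2 + q t ^+ 2))%:E)%E.
Proof.
move=> l0 l1 ip iq.
have r0 : 0 <= 2 * (1 + rho ^+ 2) by rewrite mulr_ge0// addr_ge0// sqr_ge0.
have mp := measurable_integrable ip; have mq := measurable_integrable iq.
have mN : measurable_fun setT (fun w => `|w| `^ (- lambda) * two_sided_spectrum rho p q w).
  have mH := measurable_two_sided_spectrum rho mp mq; by measurability.
have N0 w : 0 <= `|w| `^ (- lambda) * two_sided_spectrum rho p q w.
  by rewrite mulr_ge0 ?powR_ge0 ?two_sided_spectrum_ge0.
have mNE : measurable_fun setT (fun w => (`|w| `^ (- lambda) * two_sided_spectrum rho p q w)%:E).
  exact/measurable_EFinP.
have NE0 w : (0 <= (`|w| `^ (- lambda) * two_sided_spectrum rho p q w)%:E)%E.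
  by rewrite lee_fin.
have n1 : -1 != 0 :> R by rewrite oppr_eq0 oner_eq0.
have refl := ge0_integral_affine 0 n1 mNE NE0.
have {}refl : (\int[mu]_w (`|w| `^ (- lambda) * two_sided_spectrum rho p q (- w))%:E =
   \int[mu]_w (`|w| `^ (- lambda) * two_sided_spectrum rho p q w)%:E)%E.
  rewrite -[RHS]mul1e -(invr1 R) -(normrN1 R) -refl.
  by apply: eq_integral => w _; rewrite mulN1r addr0 normrN.
have mNN : measurable_fun setT (fun w => `|w| `^ (- lambda) * two_sided_spectrum rho p q (- w)).
  have mH := measurable_two_sided_spectrum rho mp mq; by measurability.
have NN0 w : 0 <= `|w| `^ (- lambda) * two_sided_spectrum rho p q (- w).
  by rewrite mulr_ge0 ?powR_ge0 ?two_sided_spectrum_ge0.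
have msp := measurable_spectrum mp; have msq := measurable_spectrum mq.
have wsp0 (g : R -> R) w : 0 <= `|w| `^ (- lambda) * spectrum g w.
  by rewrite mulr_ge0 ?powR_ge0 ?spectrum_ge0.
have h2 : (2%:E * \int[mu]_w (`|w| `^ (- lambda) * two_sided_spectrum rho p q w)%:E =
  (2 * (1 + rho ^+ 2))%:E * (\int[mu]_w (`|w| `^ (- lambda) * spectrum p w)%:E +
     \int[mu]_w (`|w| `^ (- lambda) * spectrum q w)%:E))%E.
  have mWp : measurable_fun setT (fun w => `|w| `^ (- lambda) * spectrum p w) by measurability.
  have mWq : measurable_fun setT (fun w => `|w| `^ (- lambda) * spectrum q w) by measurability.
  rewrite mule_natl mule2n -[X in (_ + X)%E]refl -(ge0_integral_add mN mNN N0 NN0).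
  rewrite -(ge0_integral_add mWp mWq (wsp0 p) (wsp0 q)).
  have mWW : measurable_fun setT (fun w => `|w| `^ (- lambda) * spectrum p w +
    `|w| `^ (- lambda) * spectrum q w) by exact: measurable_funD.
  have WW0 w : 0 <= `|w| `^ (- lambda) * spectrum p w + `|w| `^ (- lambda) * spectrum q w.
    by apply: addr_ge0; exact: wsp0.
  rewrite -(ge0_integral_mull r0 mWW WW0).
  apply: eq_integral => w _; congr EFin.
  by rewrite -mulrDr two_sided_spectrumD//; ring.
rewrite -(@lee_pmul2l _ 2%:E) ?lte_fin ?h2; [|exact: erefl|exact: ltr0n].
have W0 (g : R -> R) t : 0 <= `|t| `^ lambda * g t ^+ 2.
  by apply: mulr_ge0; [exact: powR_ge0|exact: sqr_ge0].
rewrite (_ : \int[mu]_t (`|t| `^ lambda * (p t ^+ 2 + q t ^+ 2))%:E =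
  \int[mu]_t (`|t| `^ lambda * p t ^+ 2)%:E + \int[mu]_t (`|t| `^ lambda * q t ^+ 2)%:E)%E; last first.
  have mtp : measurable_fun setT (fun t : R => `|t| `^ lambda * p t ^+ 2) by measurability.
  have mtq : measurable_fun setT (fun t : R => `|t| `^ lambda * q t ^+ 2) by measurability.
  rewrite -(ge0_integral_add mtp mtq (W0 p) (W0 q)).
  by apply: eq_integral => t _; rewrite mulrDr.
rewrite muleA -EFinM.
rewrite (_ : 2 * (2 * pi * pitt_const lambda * (1 + rho ^+ 2)) =
  2 * (1 + rho ^+ 2) * (2 * pi * pitt_const lambda)); last by ring.
rewrite (EFinM (2 * (1 + rho ^+ 2))) -muleA; apply: lee_wpmul2l; first by rewrite lee_fin.
rewrite ge0_muleDr; last 2 first.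
- by apply: integral_ge0 => t _; rewrite lee_fin.
- by apply: integral_ge0 => t _; rewrite lee_fin.
by apply: leeD; exact: pitt_real.
Qed.

Lemma cmodV (w : R[i]) : cmod w^-1 = (cmod w)^-1.
Proof. exact: Normc.normcV. Qed.

Lemma Rintegral_linear (k l : R) p q :
  mu.-integrable setT (EFin \o p) -> mu.-integrable setT (EFin \o q) ->
  mu.-integrable setT (EFin \o (fun t => k * p t + l * q t)) /\
  \int[mu]_t (k * p t + l * q t) = k * \int[mu]_t p t + l * \int[mu]_t q t.
Proof.
move=> ip iq; have ikp := integrable_mull k ip; have ilq := integrable_mull l iq.
split; last by rewrite RintegralD// !RintegralZl.
by have := integrableD measurableT ikp ilq; apply: eq_integrable => // t _ /=; rewrite EFinD.
Qed.

Lemma Rintegral_linear4 (k1 k2 k3 k4 : R) (p1 p2 p3 p4 : R -> R) :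
  mu.-integrable setT (EFin \o p1) -> mu.-integrable setT (EFin \o p2) ->
  mu.-integrable setT (EFin \o p3) -> mu.-integrable setT (EFin \o p4) ->
  \int[mu]_t (k1 * p1 t + k2 * p2 t + (k3 * p3 t + k4 * p4 t)) =
  k1 * \int[mu]_t p1 t + k2 * \int[mu]_t p2 t +
  (k3 * \int[mu]_t p3 t + k4 * \int[mu]_t p4 t).
Proof.
move=> i1 i2 i3 i4.
have [j1 e1] := Rintegral_linear k1 k2 i1 i2.
have [j2 e2] := Rintegral_linear k3 k4 i3 i4.
by rewrite RintegralD// e1 e2.
Qed.

Lemma Otransform_kernelE (rho theta : R) (x : R[i]) :
  (expi (- theta) + (0 +i* rho) * expi theta) / 2 * x =
  (2^-1 * (complex.Re x * cos theta - rho * (complex.Re x * sin theta)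
     - rho * (complex.Im x * cos theta) + complex.Im x * sin theta)) +i*
  (2^-1 * (complex.Im x * cos theta - rho * (complex.Im x * sin theta)
     + rho * (complex.Re x * cos theta) - complex.Re x * sin theta)).
Proof.
have -> : (2 : R[i])^-1 = (2^-1 : R) +i* 0 by rewrite -[RHS]/((2^-1 : R)%:C) fmorphV rmorph_nat.
rewrite /expi cosN sinN; case: x => x y.
by apply/eqP; rewrite eq_complex /=; apply/andP; split; apply/eqP; ring.
Qed.

(** The outer chirp has modulus 1. The factor collects [|csc alpha|] from [cfactor], [1 / (2 pi)]
    from the normalization and [1 / 4] from the halved kernel. *)
Lemma sqr_cmod_Otransform (alpha rho : R) f s : sin alpha != 0 -> schwartz f ->
  cmod (Otransform alpha (0 +i* rho) f s) ^+ 2 =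
  `|csc alpha| / (8 * pi) * two_sided_spectrum rho
    (chirp_re (cot alpha / 2) f) (chirp_im (cot alpha / 2) f) (csc alpha * s).
Proof.
move=> s0 sf; rewrite /Otransform; set a := cot alpha / 2; set w := csc alpha * s.
pose p := chirp_re a f; pose q := chirp_im a f.
have [ip iq] := integrable_chirp a sf; rewrite -/p -/q in ip iq *.
set I := cintegral _.
rewrite !cmodM !exprMn cmod_cfactor// cmod_expi mulr1 cmodV exprVn.
have -> : cmod (Num.sqrt (2 * pi) : R)%:C ^+ 2 = 2 * pi.
  by rewrite sqr_cmod /= expr0n/= addr0 sqr_sqrtr// mulr_ge0// pi_ge0.
have icp := integrable_mul_cos w ip; have isp := integrable_mul_sin w ip.
have icq := integrable_mul_cos w iq; have isq := integrable_mul_sin w iq.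
have EI t : (expi (- (s * t * csc alpha)) + (0 +i* rho) * expi (s * t * csc alpha)) / 2
    * expi (a * t ^+ 2) * f t =
  (2^-1 * (p t * cos (w * t) - rho * (p t * sin (w * t)) - rho * (q t * cos (w * t)) + q t * sin (w * t))) +i*
  (2^-1 * (q t * cos (w * t) - rho * (q t * sin (w * t)) + rho * (p t * cos (w * t)) - p t * sin (w * t))).
  by rewrite -mulrA Otransform_kernelE (_ : s * t * csc alpha = w * t)// /w; ring.
have -> : I = (2^-1 * (cos_transform p w - rho * sin_transform p w - rho * cos_transform q w + sin_transform q w)) +i*
  (2^-1 * (cos_transform q w - rho * sin_transform q w + rho * cos_transform p w - sin_transform p w)).
  rewrite /I /cintegral; congr (_ +i* _).
    transitivity (2^-1 * cos_transform p w + (- (2^-1 * rho)) * sin_transform p w +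
      ((- (2^-1 * rho)) * cos_transform q w + 2^-1 * sin_transform q w)); last by ring.
    by rewrite -Rintegral_linear4//; apply: eq_Rintegral => t _; rewrite EI/=; ring.
  transitivity (2^-1 * cos_transform q w + (- (2^-1 * rho)) * sin_transform q w +
    (2^-1 * rho * cos_transform p w + (- 2^-1) * sin_transform p w)); last by ring.
  by rewrite -Rintegral_linear4//; apply: eq_Rintegral => t _; rewrite EI/=; ring.
rewrite sqr_cmod /two_sided_spectrum/=.
have := lt0r_neq0 (pi_gt0 R); generalize (pi : R) => P P0.
by field.
Qed.

End Otransform.

Theorem mainTheorem4 (R : realType) (alpha rho lambda : R) (z : R[i])
    (halpha : forall k : int, alpha != k%:~R * pi)
    (hrho : rho != 0) (hz : z = 0 +i* rho)
    (hlambda0 : 0 <= lambda) (hlambda1 : lambda < 1)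
    (f : R -> R[i]) (hf : schwartz f) :
  ((`|csc alpha| `^ (- lambda))%:E *
    \int[lebesgue_measure]_s
      (`|s| `^ (- lambda) * cmod (Otransform alpha z f s) ^+ 2)%:E
   <= (4^-1 * pitt_const lambda * (1 + cmod z ^+ 2))%:E *
    \int[lebesgue_measure]_t (`|t| `^ lambda * cmod (f t) ^+ 2)%:E)%E.
Proof.
have s0 := sin_neq0 halpha; have k0 : csc alpha != 0 by rewrite invr_eq0.
have nk0 : 0 < `|csc alpha| by rewrite normr_gt0.
pose p := chirp_re (cot alpha / 2) f; pose q := chirp_im (cot alpha / 2) f.
have [ip iq] := integrable_chirp (cot alpha / 2) hf.
have [mp mq] := measurable_chirp (cot alpha / 2) hf.
have mH := measurable_two_sided_spectrum rho mp mq.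
pose N w := `|w| `^ (- lambda) * two_sided_spectrum rho p q w.
have N0 w : 0 <= N w by rewrite mulr_ge0 ?powR_ge0 ?two_sided_spectrum_ge0.
have mN : measurable_fun setT N by rewrite /N; measurability.
have c0 : 0 <= `|csc alpha| / (8 * pi) by rewrite divr_ge0// mulr_ge0// pi_ge0.
have NE0 w : (0 <= (EFin \o N) w)%E by rewrite lee_fin.
have mNE : measurable_fun setT (EFin \o N) by exact/measurable_EFinP.
have mNk : measurable_fun setT (fun s => N (csc alpha * s)) by measurability.
rewrite hz -ge0_integral_mull ?powR_ge0//; last 2 first.
- rewrite (_ : (fun s => _) = fun s => `|s| `^ (- lambda) * (`|csc alpha| / (8 * pi) *
    two_sided_spectrum rho p q (csc alpha * s))); first by measurability.
  by apply/funext => s; rewrite sqr_cmod_Otransform.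
- by move=> s; rewrite mulr_ge0 ?powR_ge0 ?sqr_ge0.
(* The outer power of [|csc alpha|] merges with [|s|^{- lambda}] into the weight at the frequency
   [csc alpha * s]. *)
rewrite [leLHS](_ : _ = ((`|csc alpha| / (8 * pi))%:E *
    \int[lebesgue_measure]_s (EFin \o N) (csc alpha * s + 0)%R)%E); last first.
  rewrite -ge0_integral_mull//; last by under eq_fun do rewrite addr0.
  apply: eq_integral => s _; congr EFin; rewrite sqr_cmod_Otransform// /N addr0 normrM.
  by rewrite powRM//; ring.
rewrite ge0_integral_affine// muleA -EFinM.
(* The Jacobian of the change of frequency cancels the modulus of [cfactor] squared. *)
have -> : `|csc alpha| / (8 * pi) * `|csc alpha|^-1 = (8 * pi)^-1.
  by rewrite mulrAC divff ?mul1r// gt_eqF.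
have pi8 : (0 <= (8 * pi : R)^-1%:E)%E by rewrite lee_fin invr_ge0 mulr_ge0// pi_ge0.
apply: (le_trans (lee_wpmul2l pi8 (pitt_two_sided rho hlambda0 hlambda1 ip iq))).
(* The constants agree since [2 pi / (8 pi) = 1 / 4] and [|z|^2 = rho^2]; the integrals agree since
   the chirp preserves the modulus of [f]. *)
rewrite muleA -EFinM le_eqVlt; apply/orP; left; apply/eqP; congr (_ * _)%E.
  rewrite sqr_cmod/= expr0n/= add0r; congr EFin.
  have := lt0r_neq0 (pi_gt0 R); generalize (pitt_const lambda) => C; generalize (pi : R) => P P0.
  by field.
by apply: eq_integral => t _; rewrite chirp_sqr.
Qed.
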